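(* For every fixed $\alpha\in[0,1)$ there exists a subexponential distribution $F$ on ${\bf R}^+=[0,\infty)$ with finite mean such that the distribution $G_\alpha$ on ${\bf R}^+$ with tail $$\overline{G_\alpha}(x)=\min\Bigl(1,\int_1^\infty\frac{\overline F(x+y)}{y^\alpha}\,dy\Bigr),\quad x\ge 0,$$ is not subexponential. In particular (case $\alpha=0$), there exists a subexponential distribution $F$ with finite mean whose integrated tail distribution $F^I$ is not subexponential.
   Context: For a distribution $G$, $\overline G(x)=G((x,\infty))$. A distribution $G$ on ${\bf R}^+$ with unbounded support is subexponential if $\overline{G*G}(x)/\overline G(x)\to 2$ as $x\to\infty$, where $*$ denotes convolution. For $F$ with finite mean, the integrated tail distribution $F^I$ is the distribution on ${\bf R}^+$ with tail $\overline{F^I}(x)=\min\bigl(1,\int_0^\infty\overline F(x+u)\,du\bigr)$, $x>0$. *)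

(* Defs.v *)
From HB Require Import structures.
From mathcomp Require Import all_boot all_order all_algebra.
From mathcomp Require Import all_classical all_reals all_analysis measurable_realfun.

Set Implicit Arguments.
Unset Strict Implicit.
Unset Printing Implicit Defensive.

Import Order.TTheory GRing.Theory Num.Theory.
Import numFieldNormedType.Exports.

Local Open Scope classical_set_scope.
Local Open Scope ring_scope.

(* Distributions on the real line are Borel probability measures. *)
Notation distr R := (probability (measurableTypeR R) R).

(* The value of a probability measure is finite, so [fine] loses nothing. *)
Definition tail (R : realType) (G : distr R) (x : R) : R :=
  fine (G `]x, +oo[%classic).

Definition on_Rplus (R : realType) (G : distr R) : Prop :=
  G `[0, +oo[%classic = 1%E.

Definition addRR (R : realType)
    (z : measurableTypeR R * measurableTypeR R) : measurableTypeR R :=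
  (z.1 : R) + z.2.

Lemma measurable_addRR (R : realType) : measurable_fun [set: _] (@addRR R).
Proof. exact: measurable_funD. Qed.

HB.instance Definition _ (R : realType) :=
  isMeasurableFun.Build _ _ _ _ (@addRR R) (@measurable_addRR R).

(* Law of the sum of the two coordinates under the product measure. *)
Definition convolution (R : realType) (F G : distr R) : distr R :=
  distribution (F \x G)%E (@addRR R).

(* For a distribution on the half-line, unboundedness of the support means that
   no tail vanishes. *)
Definition unbounded_support (R : realType) (G : distr R) : Prop :=
  forall x : R, 0 < tail G x.

Definition subexponential (R : realType) (G : distr R) : Prop :=
  [/\ on_Rplus G, unbounded_support G &
      tail (convolution G G) x / tail G x @[x --> +oo] --> (2 : R)].

Definition finite_mean (R : realType) (F : distr R) : Prop :=
  F.-integrable [set: measurableTypeR R] (fun x => (x : R)%:E).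

(* The integrals below are extended-real valued: they are allowed to be +oo,
   in which case the minimum is 1.  A distribution on the half-line is
   determined by its tail on ]0, +oo[, hence each of the two predicates
   below is satisfied by at most one [G]. *)
Definition is_G_alpha (R : realType) (alpha : R) (F G : distr R) : Prop :=
  on_Rplus G /\
  forall x : R, 0 <= x ->
    (tail G x)%:E =
    mine 1%E (\int[lebesgue_measure]_(y in `[1%R, +oo[)
                (tail F (x + y) / y `^ alpha)%:E)%E.

Definition is_integrated_tail (R : realType) (F G : distr R) : Prop :=
  on_Rplus G /\
  forall x : R, 0 < x ->
    (tail G x)%:E =
    mine 1%E (\int[lebesgue_measure]_(u in `[0%R, +oo[)
                (tail F (x + u))%:E)%E.

(* Main.v *)
Require Import Defs.
From HB Require Import structures.
From mathcomp Require Import all_boot all_order all_algebra.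
From mathcomp Require Import all_classical all_reals all_analysis.
From mathcomp Require Import measurable_realfun.
From mathcomp Require Import ring lra zify.
Import Order.TTheory GRing.Theory Num.Theory.
Import numFieldNormedType.Exports.
Local Open Scope classical_set_scope.
Local Open Scope ring_scope.

(** The distribution F is a mixture of exponential laws with very sparse
    scales: an atom at 0 and, for j >= 1, weight p_j on the exponential law of
    rate r_j, so that its tail is the sum of the p_j e_j(x) with
    e_j(x) = exp(- r_j x). An integral of the shifted tail of F against a
    kernel k only multiplies p_j by the Laplace transform c_j of k at r_j: the
    result is the tail of a mixture with the same rates and the weights
    q_j = p_j c_j, completed by an atom at 0. Hence it suffices to find rates
    for which the weights p_j give a subexponential mixture and the larger
    weights q_j do not ([counterexample]).

    The tail of the self-convolution of a mixture is a double sum. For distinct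
    rates, the tail of the convolution of two components is about the larger of
    their two tails, by Chernoff's bound, and these terms sum up to twice the
    tail of the mixture. Two copies of the component j give
    (1 + r_j x) e_j(x), and everything depends on the extra terms
    p_j^2 r_j x e_j(x) ([convolution_expo_diag]). Such a term is small against
    p_j e_j(x) until r_j x reaches 1 / p_j, where p_j e_j(x) has become
    p_j exp(- 1 / p_j).
    - If p_(j+1) is much larger than exp(- eps / p_j) for all eps > 0, then the
      component j+1 has taken over by then and the extra terms are negligible:
      the mixture is subexponential ([expmix_subexponential]).
    - If p_(j+1) is smaller than p_j^2 exp(- 1 - 1 / p_j), then the component j
      still dominates at r_j x = 1 + 1 / p_j, where the extra term is comparable
      with the whole tail: the mixture is not subexponential
      ([expmix_not_subexponential]).

    With v_j growing fast and N = m + 2, take p_j = v_j^(-2N), r_j = v_j^(-N)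
    and p_(j+1) = exp(- v_j^(2N-1)). The exponent 2N-1 < 2N gives the first
    regime ([weight_slow]), and the mean is finite because p_j / r_j = v_j^(-N).
    For the kernel y^(-alpha) on [1, +oo[ the factor c_j is of order
    v_j^(N(1-alpha)), so that once N (1 - alpha) >= 2 the number 1 / q_j is at
    most of order v_j^(2N-2): the exponent 2N-2 < 2N-1 gives the second regime
    ([tilted_fast]). *)

(** * Integration against a measure with density *)

Section density.
Local Open Scope ereal_scope.
Import HBNNSimple.
Context d (T : measurableType d) (R : realType).
Variables (nu m : {measure set T -> \bar R}) (g : T -> R).
Hypothesis g0 : forall x, (0 <= g x)%R.
Hypothesis mg : measurable_fun [set: T] g.
Hypothesis nuE : forall A, measurable A -> nu A = \int[m]_(x in A) (g x)%:E.

Let integral_density_nnsfun (f : {nnsfun T >-> R}) :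
  \int[nu]_x (f x)%:E = \int[m]_x ((f x)%:E * (g x)%:E).
Proof.
under [LHS]eq_integral do rewrite fimfunE -fsumEFin//.
rewrite [LHS]ge0_integral_fsum//; last 2 first.
  - by move=> r; exact/measurable_EFinP/measurableT_comp.
  - by move=> n x _; rewrite EFinM nnfun_muleindic_ge0.
under [RHS]eq_integral.
  move=> x xD; rewrite muleC fimfunE -fsumEFin// ge0_mule_fsumr; last first.
    by move=> r; rewrite EFinM nnfun_muleindic_ge0.
  over.
rewrite [RHS]ge0_integral_fsum//; last 2 first.
  - move=> r; apply: emeasurable_funM; first exact/measurable_EFinP.
    by apply/measurable_EFinP; do 2 apply/measurableT_comp => //.
  - by move=> n x _; rewrite mule_ge0 ?lee_fin// -lee_fin EFinM nnfun_muleindic_ge0.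
apply: eq_fsbigr => r; rewrite inE/= => -[z _ zr].
have r0 : (0 <= r)%R by rewrite -zr.
have mI : measurable (f @^-1` [set r]) by [].
under eq_integral do rewrite EFinM.
under [RHS]eq_integral do rewrite EFinM muleCA.
have mgE : measurable_fun setT (fun x => (g x)%:E) by exact/measurable_EFinP.
have mIE : measurable_fun setT (fun x => (\1_(f @^-1` [set r]) x)%:E : \bar R).
  exact/measurable_EFinP/measurable_indic.
have I0 x : 0 <= (\1_(f @^-1` [set r]) x)%:E :> \bar R by rewrite lee_fin indicE ler0n.
rewrite ge0_integralZl// [RHS]ge0_integralZl//; last 2 first.
- exact: emeasurable_funM.
- by move=> x _; rewrite mule_ge0// lee_fin.
congr (_ * _); rewrite integral_indic// setIT nuE//.
rewrite integral_mkcond; apply: eq_integral => x _.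
rewrite patchE indicE; case: ifPn => _; by rewrite ?mule1 ?mule0.
Qed.

(** Monotone approximation by simple functions reduces this to indicators,
    where it is the hypothesis on [nu]. *)
Lemma integral_density (f : T -> \bar R) : measurable_fun [set: T] f ->
  (forall x, 0 <= f x) -> \int[nu]_x f x = \int[m]_x (f x * (g x)%:E).
Proof.
move=> mf f0; pose f_ := nnsfun_approx measurableT mf.
have cf x : (f_ n x)%:E @[n --> \oo] --> f x by exact: cvg_nnsfun_approx.
transitivity (lim (\int[nu]_x (f_ n x)%:E @[n --> \oo])).
  rewrite -monotone_convergence//=.
  - by apply: eq_integral => x _; apply/esym/cvg_lim.
  - by move=> n; exact/measurable_EFinP/measurable_funTS.
  - by move=> n ? _; rewrite lee_fin.
  - by move=> ? _ ? ? mn; rewrite lee_fin; exact/lefP/nd_nnsfun_approx.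
under eq_fun do rewrite integral_density_nnsfun.
rewrite -monotone_convergence//=.
- apply: eq_integral => x _; apply/cvg_lim => //.
  by apply: cvgeZr => //; exact: cf.
- move=> n; apply: emeasurable_funM; exact/measurable_EFinP/measurable_funTS.
- by move=> n x _; rewrite mule_ge0// lee_fin.
- move=> x _ a b ab; rewrite lee_wpmul2r ?lee_fin//.
  exact/lefP/nd_nnsfun_approx.
Qed.
End density.

(** * Tails of convolutions *)

Section convolution_facts.
Context (R : realType).
Implicit Types (mu nu : distr R).

Lemma measurable_tail_fun mu (x : R) :
  measurable_fun [set: R] (fun y : R => mu `]x - y, +oo[%classic).
Proof.
pose A := [set z : R * R | x < z.1 + z.2].
have mA : measurable A.
  have := @measurable_addRR R measurableT `]x, +oo[%classic (measurable_itv _).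
  rewrite setTI; congr (measurable _); apply/seteqP; split => z /=;
  by rewrite in_itv/= andbT.
have := @measurable_fun_xsection _ _ _ _ _ mu _ mA.
congr measurable_fun; apply/funext => y/=; congr (mu _).
apply/seteqP; split => z /=; rewrite /xsection/= inE/= in_itv/= andbT;
rewrite /A/=; lra.
Qed.

Lemma convolution_itv mu nu (x : R) :
  convolution mu nu `]x, +oo[%classic =
  (\int[mu]_y nu `](x - (y : R))%R, +oo[%classic)%E.
Proof.
rewrite /convolution /distribution /pushforward /product_measure1/=.
apply: eq_integral => y _/=; congr (nu _).
apply/seteqP; split => z /=; rewrite /xsection/= inE/= /addRR in_itv/= in_itv/= !andbT; lra.
Qed.

Lemma convolutionC mu nu (A : set R) : measurable A ->
  convolution mu nu A = convolution nu mu A.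
Proof.
move=> mA; rewrite /convolution /distribution /pushforward/=.
set B := _ @^-1` A.
have mB : measurable B.
  by rewrite -[B]setTI; exact: measurable_addRR.
transitivity ((mu \x^ nu)%E B).
  by apply: product_measure_unique => //= ? ? ? ?; rewrite product_measure2E.
rewrite /product_measure2 /product_measure1; apply: eq_integral => y _ /=.
congr (mu _); apply/seteqP; split => z /=.
  by rewrite /ysection/xsection/= !inE /B/= /addRR/= addrC.
by rewrite /ysection/xsection/= !inE /B/= /addRR/= addrC.
Qed.

(** For laws on the half-line this is P(X + Y > x) >= P(max(X, Y) > x), the
    product being subtracted by inclusion and exclusion. *)
Lemma convolution_ge mu nu (x : R) : on_Rplus mu -> on_Rplus nu -> 0 <= x ->
  (mu `]x, +oo[%classic + nu `]x, +oo[%classic <=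
   convolution mu nu `]x, +oo[%classic +
   mu `]x, +oo[%classic * nu `]x, +oo[%classic)%E.
Proof.
move=> mu0 nu0 x0; rewrite convolution_itv.
set a := mu _; set b := nu _.
have mf := measurable_tail_fun nu x.
have split0 : `[0, +oo[%classic = `[0, x]%classic `|` `]x, +oo[%classic :> set R.
  by apply/seteqP; split => y /=; rewrite !in_itv/= ?andbT; lra.
have disj : [disjoint `[0%R, x]%classic & `]x, +oo[%classic].
  apply/disj_setPS => y/= []; rewrite !in_itv/= andbT; lra.
have mu0x : (mu `[0%R, x]%classic + a = 1)%E.
  rewrite -[RHS]mu0 split0 measureU//; exact/disj_set2P.
have intge : (b * mu `[0%R, x]%classic + a <=
    \int[mu]_y nu `](x - (y : R))%R, +oo[%classic)%E.
  apply: (@le_trans _ _ (\int[mu]_(y in `[0%R, +oo[)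
      nu `](x - (y : R))%R, +oo[%classic)%E); last first.
    exact: ge0_subset_integral.
  rewrite split0 ge0_integral_setU//=; last first.
    by rewrite -split0; exact: measurable_funTS.
  apply: leeD.
    rewrite -integral_cst//; apply: ge0_le_integral => //.
      exact: measurable_funTS.
    move=> y /=; rewrite in_itv/= => /andP[y0 _].
    apply: le_measure; rewrite ?inE//.
    by move=> z /=; rewrite !in_itv/= !andbT; lra.
  rewrite -[leLHS]mul1e -integral_cst//; apply: ge0_le_integral => //.
    exact: measurable_funTS.
  move=> y /=; rewrite in_itv/= andbT => y0.
  rewrite -[leLHS]nu0; apply: le_measure; rewrite ?inE//.
  by move=> z /=; rewrite !in_itv/= !andbT; lra.
apply: (@le_trans _ _ (b * mu `[0%R, x]%classic + a + a * b)%E); last first.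
  exact: leeD2r.
have a0 : (0 <= a)%E by exact: measure_ge0.
by rewrite addeAC (muleC a) -ge0_muleDr// mu0x mule1 addeC.
Qed.
End convolution_facts.

(** * Exponential laws *)

Section exponential.
Context (R : realType).
Implicit Types (r t x y : R).

(** The rate 0 encodes the Dirac mass at 0, so that an atom at 0 is a component
    of a mixture like the others. *)
Definition expo r : distr R :=
  match pselect (0 < r) with
  | left r0 =>
    @exponential_distribution_exponential_prob__canonical__probability_measure_Probability
      R r r0
  | right _ => @dirac _ (measurableTypeR R) (0 : R) R
  end.

Lemma expo_dirac r (A : set R) : r <= 0 -> expo r A = (\1_A (0 : R))%:E.
Proof.
by rewrite /expo; case: pselect => // r0; rewrite leNgt r0.
Qed.

Lemma expoE r (A : set R) : 0 < r -> measurable A ->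
  expo r A =
  (\int[lebesgue_measure]_(x in A) (exponential_pdf r x)%:E)%E.
Proof. by rewrite /expo; case: pselect. Qed.

Lemma integral_expR_itvy r (a : R) : 0 < r ->
  (\int[lebesgue_measure]_(y in `[a, +oo[) (r * expR (- r * y))%:E =
   (expR (- r * a))%:E)%E.
Proof.
move=> r0.
have cexp : continuous (fun z : R^o => expR (- r * z)).
  move=> z; apply: continuous_comp; last exact: continuous_expR.
  by apply: continuousM => //; apply: (@continuousN _ R^o); exact: cst_continuous.
rewrite (@ge0_continuous_FTC2y _ _ (fun x => - (expR (- r * x))) _ 0)//.
- by rewrite EFinN oppeK add0e.
- by move=> x _; rewrite mulr_ge0 ?expR_ge0 ?ltW.
- apply: continuous_subspaceT => z.
  apply: (@continuousM _ R^o (fun=> r) (fun z => expR (- r * z))).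
    exact: cst_continuous.
  exact: cexp.
- rewrite -oppr0; apply: cvgN.
  rewrite (_ : (fun x => expR (- r * x)) =
               (fun z => expR (- z)) \o (fun z => r * z)); last first.
    by apply: eq_fun => x; rewrite mulNr.
  apply: (@cvg_comp _ _ _ _ _ _ (pinfty_nbhs R)); last exact: cvgr_expR.
  exact: gt0_cvgMry.
- by apply: cvgN; apply/cvg_at_right_filter; exact: cexp.
- move=> z _.
  rewrite derive1_comp// derive1N// derive1_id mulN1r derive1_comp// derive1E.
  have /funeqP -> := @derive_expR R.
  by rewrite derive1Ml// derive1_id mulr1 mulrN opprK mulrC.
Qed.

(** The tail of [expo r] at the points x >= 0; it vanishes for the Dirac mass. *)
Definition etail r x : R := if 0 < r then expR (- r * x) else 0.

Lemma etail_ge0 r x : 0 <= etail r x.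
Proof. by rewrite /etail; case: ifP => // _; exact: expR_ge0. Qed.

Lemma etail_le1 r x : 0 <= x -> etail r x <= 1.
Proof.
move=> x0; rewrite /etail; case: ifP => // r0.
by rewrite -[leRHS]expR0 ler_expR mulNr oppr_le0 mulr_ge0// ltW.
Qed.

Lemma expo_itv r x : 0 <= x -> expo r `]x, +oo[%classic = (etail r x)%:E.
Proof.
move=> x0; rewrite /etail; case: ifPn => [r0|]; last first.
  rewrite -leNgt => r0; rewrite expo_dirac// indicE memNset//=.
  by rewrite in_itv/= andbT; apply/negP; rewrite -leNgt.
rewrite expoE// integral_itv_obnd_cbnd; last first.
  by apply/measurable_funTS/measurable_EFinP; exact: measurable_exponential_pdf.
rewrite -integral_expR_itvy//; apply: eq_integral => y.
rewrite inE/= in_itv/= andbT => xy; rewrite exponential_pdfE//.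
exact: le_trans xy.
Qed.

Lemma expo_Rplus r : on_Rplus (expo r).
Proof.
rewrite /on_Rplus; have [r0|r0] := ltP 0 r; last first.
  by rewrite expo_dirac// indicE mem_set//= in_itv/= lexx.
rewrite expoE//.
have <- : (expR (- r * 0))%:E = 1%E :> \bar R by rewrite mulr0 expR0.
rewrite -integral_expR_itvy//; apply: eq_integral => y.
by rewrite inE/= in_itv/= andbT => y0; rewrite exponential_pdfE.
Qed.

Lemma integral_expo r (f : R -> \bar R) : 0 < r ->
  measurable_fun [set: R] f -> (forall x, (0 <= f x)%E) ->
  (\int[expo r]_x f x =
   \int[lebesgue_measure]_(x in `[0%R, +oo[) (f x * (r * expR (- r * x))%:E))%E.
Proof.
move=> r0 mf f0.
rewrite (@integral_density _ _ _ (expo r) lebesgue_measure (exponential_pdf r))//.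
- rewrite [RHS]integral_mkcond; apply: eq_integral => x _.
  rewrite patchE; case: ifPn.
    by rewrite inE/= in_itv/= andbT => x0; rewrite exponential_pdfE.
  rewrite notin_setE/= in_itv/= andbT => /negP; rewrite -ltNge => x0.
  by rewrite lt0_exponential_pdf// mule0.
- by move=> x; exact/exponential_pdf_ge0/ltW.
- exact: measurable_exponential_pdf.
- by move=> A mA; exact: expoE.
Qed.

Lemma integral_dirac_expo r (f : R -> \bar R) : r <= 0 ->
  measurable_fun [set: R] f -> (\int[expo r]_x f x)%E = f 0.
Proof.
move=> r0 mf; rewrite /expo; case: pselect => [r1|_].
  by exfalso; move: r1; rewrite ltNge r0.
by rewrite integral_dirac// diracT mul1e.
Qed.

Let measurable_expRMr t : measurable_fun [set: R] (fun y : R => expR (t * y)).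
Proof.
apply: (measurableT_comp (@measurable_expR R)); exact: mulrl_measurable.
Qed.

Let measurable_expRM t : measurable_fun [set: R] (fun y : R => (expR (t * y))%:E).
Proof. by apply/measurable_EFinP; exact: measurable_expRMr. Qed.

(** The moment generating function of the exponential law of rate r at t is
    r / (r - t), because its integrand is that factor times the density of the
    law of rate r - t; the bound k also covers the Dirac mass. *)
Lemma mgf_expo_le r t (k : R) : 0 < t -> 1 <= k -> r <= 0 \/ r <= k * (r - t) ->
  (\int[expo r]_y (expR (t * y))%:E <= k%:E)%E.
Proof.
move=> t0 k1 rk; have [r0|r0] := leP r 0.
  by rewrite integral_dirac_expo ?mulr0 ?expR0 ?lee_fin//; exact: measurable_expRM.
case: rk => [|rk]; first by rewrite leNgt r0.
have rt : 0 < r - t.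
  rewrite ltNge; apply/negP => rt.
  by move: rk; rewrite leNgt (le_lt_trans _ r0)// mulr_ge0_le0// (le_trans _ k1).
rewrite integral_expo; [|by []|exact: measurable_expRM|by move=> y; rewrite lee_fin expR_ge0].
have -> : (\int[lebesgue_measure]_(y in `[0%R, +oo[)
      ((expR (t * y))%:E * (r * expR (- r * y))%:E) =
    \int[lebesgue_measure]_(y in `[0%R, +oo[)
      ((r / (r - t))%:E * ((r - t) * expR (- (r - t) * y))%:E))%E.
  apply: eq_integral => y _; rewrite -!EFinM; congr EFin.
  have -> : - (r - t) * y = t * y + - r * y by ring.
  by rewrite expRD; field; rewrite gt_eqF.
rewrite ge0_integralZl//=.
- by rewrite integral_expR_itvy// mulr0 expR0 mule1 lee_fin ler_pdivrMr.
- apply/measurable_funTS/measurable_EFinP; apply: measurable_funM => //.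
  exact: measurable_expRMr.
- by move=> y _; rewrite lee_fin mulr_ge0 ?expR_ge0// ltW.
- by rewrite lee_fin divr_ge0 ?ltW.
Qed.

Let expo_itv_le t x : 0 < t -> (expo t `]x, +oo[%classic <= (expR (- t * x))%:E)%E.
Proof.
move=> t0; have [x0|x0] := leP 0 x; first by rewrite expo_itv// /etail t0.
apply: (le_trans (probability_le1 _ _)) => //.
by rewrite lee_fin -[leLHS]expR0 ler_expR mulNr oppr_ge0 mulr_ge0_le0 ?ltW.
Qed.

(** Chernoff's bound: conditionally on X = y, the probability that an
    exponential Y of rate t exceeds x - y is at most exp(- t x) exp(t y). *)
Lemma convolution_expo_le r t k x : 0 <= x ->
  0 < t -> 1 <= k -> r <= 0 \/ r <= k * (r - t) ->
  (convolution (expo r) (expo t) `]x, +oo[%classic <= (k * etail t x)%:E)%E.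
Proof.
move=> x0 t0 k1 rk; rewrite convolution_itv /etail t0.
apply: (@le_trans _ _ (\int[expo r]_y ((expR (- t * x))%:E * (expR (t * y))%:E))%E).
  apply: ge0_le_integral => //.
  - exact: measurable_tail_fun.
  - exact: (measurable_funeM _ (measurable_expRM t)).
  - move=> y _; rewrite -EFinM -expRD.
    have -> : - t * x + t * y = - t * (x - y) by ring.
    exact: expo_itv_le.
rewrite ge0_integralZl//=.
- by rewrite [k * _]mulrC EFinM lee_wpmul2l ?lee_fin ?expR_ge0//; exact: mgf_expo_le.
- exact: measurable_expRM.
Qed.

(** On [0, x] the integrand of the convolution is the constant
    r exp(- r x), which contributes r x exp(- r x); beyond x only the tail of
    one variable is left. *)
Lemma convolution_expo_diag r x : 0 <= x ->
  convolution (expo r) (expo r) `]x, +oo[%classic = ((1 + r * x) * etail r x)%:E.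
Proof.
move=> x0; rewrite convolution_itv; have [r0|r0] := leP r 0.
  rewrite integral_dirac_expo//; last exact: measurable_tail_fun.
  by rewrite subr0 expo_itv// /etail ltNge r0/= mulr0.
rewrite integral_expo//; last exact: measurable_tail_fun.
have split0 : `[0, +oo[%classic = `[0, x]%classic `|` `]x, +oo[%classic :> set R.
  by apply/seteqP; split => y /=; rewrite !in_itv/= ?andbT; lra.
have disj : [disjoint `[0%R, x]%classic & `]x, +oo[%classic].
  apply/disj_setPS => y/= []; rewrite !in_itv/= andbT; lra.
have mr : measurable_fun [set: R] (fun y : R => (r * expR (- r * y))%:E).
  apply/measurable_EFinP.
  exact: (measurable_funM (measurable_cst r) (measurable_expRMr (- r))).
have r0' y : (0 <= (r * expR (- r * y))%:E :> \bar R)%E.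
  by rewrite lee_fin mulr_ge0 ?expR_ge0// ltW.
rewrite split0 ge0_integral_setU//=; last 2 first.
- by apply/measurable_funTS/emeasurable_funM; [exact: measurable_tail_fun|].
- by move=> y _; rewrite mule_ge0.
rewrite (eq_integral (fun=> (r * expR (- r * x))%:E)); last first.
  move=> y; rewrite inE/= in_itv/= => /andP[y0 yx].
  rewrite expo_itv ?subr_ge0// /etail r0 -EFinM; congr EFin.
  by rewrite mulrCA -expRD; congr (_ * expR _); ring.
rewrite integral_cst//= lebesgue_measure_itv/= lte_fin.
have -> : (\int[lebesgue_measure]_(y in `]x, +oo[)
      (expo r `](x - y)%R, +oo[%classic * (r * expR (- r * y))%:E) =
    \int[lebesgue_measure]_(y in `]x, +oo[) (r * expR (- r * y))%:E)%E.
  apply: eq_integral => y; rewrite inE/= in_itv/= andbT => xy.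
  suff -> : expo r `](x - y)%R, +oo[%classic = 1%E by rewrite mul1e.
  apply/eqP; rewrite eq_le probability_le1//= -(expo_Rplus r).
  apply: le_measure; rewrite ?inE//.
  by move=> z /=; rewrite !in_itv/= !andbT; lra.
rewrite integral_itv_obnd_cbnd; last exact: measurable_funTS.
rewrite integral_expR_itvy// /etail r0.
have -> : (if 0 < x then (x%:E - 0)%E else 0%E) = x%:E.
  by move: x0; rewrite le_eqVlt => /predU1P[<-|->]; rewrite ?ltxx// sube0.
by rewrite -EFinM -EFinD; congr EFin; ring.
Qed.

End exponential.

(** * Countable mixtures *)

Section mixture.
Local Open Scope ereal_scope.
Context (R : realType) (mu : nat -> distr R) (w : nat -> R).
Hypothesis w_ge0 : forall n, (0 <= w n)%R.
Hypothesis w_sum1 : \sum_(n <oo) (w n)%:E = 1.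

Definition mixture_measure of (forall n, (0 <= w n)%R) & \sum_(n <oo) (w n)%:E = 1 :
    set (measurableTypeR R) -> \bar R :=
  mseries (fun n => mscale (NngNum (w_ge0 n)) (mu n)) 0.

Local Notation M := (mixture_measure w_ge0 w_sum1).

HB.instance Definition _ := Measure.on M.

Let mixtureT : M setT = 1.
Proof.
rewrite /M /mseries -[RHS]w_sum1; apply: eq_eseriesr => n _.
by rewrite -[RHS]mule1 -(probability_setT (mu n)).
Qed.

HB.instance Definition _ := Measure_isProbability.Build _ _ _ M mixtureT.

Definition mixture : distr R := M.

Local Notation P := mixture.

Lemma mixtureE A : P A = \sum_(n <oo) (w n)%:E * mu n A.
Proof. by []. Qed.

Lemma mixture_Rplus : (forall n, on_Rplus (mu n)) -> on_Rplus P.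
Proof.
move=> h; rewrite /on_Rplus mixtureE -[RHS]w_sum1.
by apply: eq_eseriesr => n _; rewrite h mule1.
Qed.

Lemma integral_mixture (f : R -> \bar R) : measurable_fun [set: R] f ->
  (forall x, 0 <= f x) ->
  \int[P]_x f x = \sum_(n <oo) (w n)%:E * \int[mu n]_x f x.
Proof.
move=> mf f0; rewrite ge0_integral_measure_series//.
by apply: eq_eseriesr => n _; rewrite ge0_integral_mscale.
Qed.

Lemma convolution_mixture (x : R) :
  convolution P P `]x, +oo[%classic =
  \sum_(i <oo) (w i)%:E * (\sum_(j <oo) (w j)%:E *
    convolution (mu i) (mu j) `]x, +oo[%classic).
Proof.
rewrite convolution_itv integral_mixture//; last first.
  exact: (@measurable_tail_fun R P x).
apply: eq_eseriesr => i _; congr (_ * _).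
under eq_integral do rewrite mixtureE.
rewrite integral_nneseries//; last 2 first.
- move=> n; apply: measurable_funeM; exact: measurable_tail_fun.
- by move=> n y _; rewrite mule_ge0// lee_fin.
apply: eq_eseriesr => j _; rewrite convolution_itv ge0_integralZl//.
- exact: measurable_tail_fun.
- by rewrite lee_fin.
Qed.

End mixture.

(** * Double series *)

Section double_sum.
Local Open Scope ereal_scope.
Context (R : realType).

Lemma nneseries_single (k : nat) (c : R) : (0 <= c)%R ->
  \sum_(j <oo) ((k == j)%:R * c)%:E = c%:E.
Proof.
move=> c0; rewrite (@nneseriesD1 _ _ k)//; last first.
  by move=> j _; rewrite lee_fin mulr_ge0.
rewrite eqxx mul1r eseries0 ?adde0// => j _ /= jk.
by rewrite eq_sym (negbTE jk) mul0r.
Qed.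

Lemma nneseries_shift_le (f : nat -> \bar R) : (forall n, 0 <= f n) ->
  \sum_(n <oo) f n.+1 <= \sum_(n <oo) f n.
Proof.
move=> f0; rewrite [leRHS]nneseries_recl// -(@nneseries_addn R f 1%N)//.
by under eq_eseriesr do rewrite -addn1; rewrite leeDr.
Qed.

(** The shape of all the estimates of self-convolutions below: a_i + a_j
    comes from pairs of components and d_i is the excess of the pair (i, i).
    The bound M makes the sum of the p_j a_j finite, so that it can be
    factored out. *)
Lemma weighted_double_sum (p a d : nat -> R) (M : R) :
  (forall n, (0 <= p n)%R) -> (forall n, (0 <= a n <= M)%R) ->
  (forall n, (0 <= d n)%R) -> \sum_(n <oo) (p n)%:E = 1 ->
  \sum_(i <oo) (p i)%:E * (\sum_(j <oo) (p j)%:E *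
     (a i + a j + (i == j)%:R * d i)%:E) =
  \sum_(i <oo) (p i * (2 * a i + p i * d i))%:E.
Proof.
move=> p0 aM d0 p1.
have a0 n : (0 <= a n)%R by have /andP[] := aM n.
pose S := \sum_(j <oo) (p j * a j)%:E.
have S0 : 0 <= S by apply: nneseries_ge0 => j _ _; rewrite lee_fin mulr_ge0.
have Sfin : S \is a fin_num.
  rewrite ge0_fin_numE//; apply: (@le_lt_trans _ _ (M%:E)); last exact: ltry.
  rewrite -[leRHS]mule1 -p1 -nneseriesZl; last by move=> j _; rewrite lee_fin.
  apply: lee_nneseries => j _; first by rewrite lee_fin mulr_ge0.
  by rewrite -EFinM lee_fin mulrC ler_wpM2r//; have /andP[] := aM j.
have inner i : \sum_(j <oo) (p j)%:E * (a i + a j + (i == j)%:R * d i)%:E =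
    (a i + p i * d i)%:E + S.
  transitivity (\sum_(j <oo) ((a i)%:E * (p j)%:E +
      ((p j * a j)%:E + ((i == j)%:R * (p i * d i))%:E))).
    apply: eq_eseriesr => j _; rewrite -!EFinM -!EFinD; congr EFin.
    by have [->|_] := eqVneq i j; rewrite ?mul1r ?mul0r; ring.
  rewrite nneseriesD; last 2 first.
  - by move=> j _ _; rewrite mule_ge0// lee_fin.
  - by move=> j _ _; rewrite adde_ge0// lee_fin !mulr_ge0.
  rewrite nneseriesZl; last by move=> j _; rewrite lee_fin.
  rewrite nneseriesD; last 2 first.
  - by move=> j _ _; rewrite lee_fin mulr_ge0.
  - by move=> j _ _; rewrite lee_fin !mulr_ge0.
  by rewrite p1 mule1 nneseries_single ?mulr_ge0// EFinD addeA addeAC.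
transitivity (\sum_(i <oo) ((p i * (a i + p i * d i))%:E + (p i)%:E * S)).
  apply: eq_eseriesr => i _; rewrite inner ge0_muleDr ?EFinM//.
  by rewrite lee_fin addr_ge0// mulr_ge0.
rewrite nneseriesD; last 2 first.
- by move=> j _ _; rewrite lee_fin mulr_ge0// addr_ge0// mulr_ge0.
- by move=> j _ _; rewrite mule_ge0// lee_fin.
have -> : \sum_(i <oo) (p i)%:E * S = S.
  under eq_eseriesr do rewrite muleC.
  rewrite -(fineK Sfin) nneseriesZl; last by move=> j _; rewrite lee_fin.
  by rewrite p1 mule1.
rewrite /S -nneseriesD; last 2 first.
- by move=> j _ _; rewrite lee_fin mulr_ge0// addr_ge0// mulr_ge0.
- by move=> j _ _; rewrite lee_fin mulr_ge0.
apply: eq_eseriesr => i _; rewrite -EFinD; congr EFin; ring.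
Qed.
End double_sum.

(** * Criteria for subexponentiality *)

Section criteria.
Context (R : realType).
Implicit Types (F G : distr R) (x : R).

Lemma tailE F x : F `]x, +oo[%classic = (tail F x)%:E.
Proof. by rewrite /tail fineK// fin_num_measure. Qed.

Lemma tail_ge0 F x : 0 <= tail F x.
Proof. by rewrite -lee_fin -tailE. Qed.

Let idTR : measurableTypeR R -> R := idfun.

#[local] HB.instance Definition _ :=
  @isMeasurableFun.Build _ _ _ _ idTR (@measurable_id _ _ setT).

Lemma cvg_tail0 F : tail F x @[x --> +oo] --> (0 : R).
Proof.
apply: fine_cvg.
exact: (@cvg_ccdfy0 _ _ _ F (idTR : {RV F >-> R})).
Qed.

Lemma tail_convolution_ge F x : on_Rplus F -> 0 <= x ->
  2 * tail F x - tail F x ^+ 2 <= tail (convolution F F) x.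
Proof.
move=> F0 x0; have := @convolution_ge _ F F x F0 F0 x0.
rewrite tailE tailE -EFinM -!EFinD lee_fin; lra.
Qed.

(** The lower bound is automatic by [tail_convolution_ge], since the tail
    vanishes at infinity. *)
Lemma subexponential_upper F : on_Rplus F -> unbounded_support F ->
  (forall e, 0 < e -> exists X, forall x, X <= x ->
     tail (convolution F F) x <= (2 + e) * tail F x) ->
  subexponential F.
Proof.
move=> F0 Fu Fle; split => //.
apply/cvgrPdist_le => e e0.
have [X FX] := Fle _ e0.
have /cvgrPdist_le /(_ _ e0) F0e := @cvg_tail0 F.
near=> x.
have x0 : 0 <= x by near: x; apply: nbhs_pinfty_ge; exact: num_real.
have Xx : X <= x by near: x; apply: nbhs_pinfty_ge; exact: num_real.
have tx : `|0 - tail F x| <= e by near: x; exact: F0e.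
rewrite sub0r normrN ger0_norm ?tail_ge0// in tx.
have t0 := Fu x.
have lo := tail_convolution_ge _ _ F0 x0.
have up := FX x Xx.
rewrite distrC ler_distl; apply/andP; split.
  rewrite ler_pdivlMr//; nra.
by rewrite ler_pdivrMr//.
Unshelve. all: by end_near. Qed.

(** The square is harmless, since the tail vanishes at infinity; it lets
    inclusion-exclusion bounds be used as they come. *)
Lemma not_subexponential_along F (u : nat -> R) c : 0 < c ->
  (forall M, exists k, M <= u k /\
     (2 + c) * tail F (u k) <= tail (convolution F F) (u k) + tail F (u k) ^+ 2) ->
  ~ subexponential F.
Proof.
move=> c0 H [F0 Fu /cvgrPdist_lt lim2].
have c2 : 0 < c / 2 by rewrite divr_gt0.
have /cvgrPdist_lt /(_ _ c2) T0 := @cvg_tail0 F.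
have [M [Mr HM]] : \forall x \near +oo,
    `|2 - tail (convolution F F) x / tail F x| < c / 2 /\
    `|0 - tail F x| < c / 2.
  by near=> x; split; near: x; [exact: lim2|exact: T0].
have [k [Mk Hk]] := H (M + 1).
have [] := HM (u k); first by rewrite (lt_le_trans _ Mk)// ltrDl.
have t0 := Fu (u k).
rewrite distrC ltr_distl => /andP[_]; rewrite ltr_pdivrMr// => h1.
rewrite sub0r normrN ger0_norm ?ltW// => h2.
nra.
Unshelve. all: by end_near. Qed.

End criteria.

(** * Mixtures of exponential laws *)

Section exponential_mixture.
Context (R : realType) (p r : nat -> R).
Hypothesis p_ge0 : forall n, 0 <= p n.
Hypothesis p_sum1 : (\sum_(n <oo) (p n)%:E = 1)%E.
(* Index 0 is the atom at 0. *)
Hypothesis r_0 : r 0 = 0.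
Hypothesis r_gt0 : forall n, 0 < r n.+1.
Hypothesis p_gt0 : forall n, 0 < p n.+1.

Definition expmix : distr R := mixture R (fun n => expo R (r n)) p p_ge0 p_sum1.
Local Notation F := expmix.
Local Notation e n x := (etail R (r n) x).

Lemma expmix_Rplus : on_Rplus F.
Proof. by apply: mixture_Rplus => n; exact: expo_Rplus. Qed.

Lemma tail_expmix x : 0 <= x ->
  (tail F x)%:E = (\sum_(n <oo) (p n * e n x)%:E)%E.
Proof.
move=> x0; rewrite -tailE /F mixtureE; apply: eq_eseriesr => n _.
by rewrite expo_itv.
Qed.

Lemma weighted_etail_ge0 n x : 0 <= p n * e n x.
Proof. by rewrite mulr_ge0// etail_ge0. Qed.

Lemma tail_expmix_ge n x : 0 <= x -> p n * e n x <= tail F x.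
Proof.
move=> x0; rewrite -lee_fin tail_expmix// (@nneseriesD1 _ _ n)//; last first.
  by move=> k _; rewrite lee_fin weighted_etail_ge0.
by rewrite leeDl// nneseries_ge0// => k _ _; rewrite lee_fin weighted_etail_ge0.
Qed.

Lemma expmix_unbounded : unbounded_support F.
Proof.
move=> x; have x0 : 0 <= Num.max 0 x by rewrite le_max lexx.
have xx : x <= Num.max 0 x by rewrite le_max lexx orbT.
apply: (@lt_le_trans _ _ (tail F (Num.max 0 x))).
  apply: lt_le_trans (tail_expmix_ge 1 _ x0).
  by rewrite mulr_gt0// /etail r_gt0 expR_gt0.
rewrite -lee_fin -!tailE; apply: le_measure; rewrite ?inE//.
by move=> z /=; rewrite !in_itv/= !andbT; exact: le_lt_trans.
Qed.

Lemma expmix_weight_le1 n : p n <= 1.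
Proof.
rewrite -lee_fin -p_sum1 (@nneseriesD1 _ _ n)//; last first.
  by move=> k _; rewrite lee_fin.
by rewrite leeDl// nneseries_ge0// => k _ _; rewrite lee_fin.
Qed.

Section subexp.
Variable delta : nat -> R.
Hypothesis delta_bnd : forall n, 0 <= delta n <= 4^-1.
Hypothesis delta_cvg : forall eps, 0 < eps ->
  exists J, forall j, (J <= j)%N -> delta j <= eps.
Hypothesis r_delta : forall i j, (0 < i < j)%N -> r j <= delta j * r i.
Hypothesis p_slow : forall eps, 0 < eps ->
  exists J, forall j, (J <= j)%N -> expR (- (eps / p j)) <= eps * p j.+1.

(* From r_j <= delta_j r_i one gets r_i / (r_i - r_j) <= 1 + 2 delta_j, the
   Chernoff factor for the pair (i, j). *)
Let kappa n := 1 + 2 * delta n.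

Let kappa_bnd n : 1 <= kappa n <= 2.
Proof. by have /andP[] := delta_bnd n; rewrite /kappa; lra. Qed.

Let conv_lt i j x : 0 <= x -> (i < j)%N ->
  (convolution (expo R (r i)) (expo R (r j)) `]x, +oo[%classic <= (kappa j * e j x)%:E)%E.
Proof.
move=> x0 ij; case: j ij => // j ij.
apply: convolution_expo_le => //; first by have /andP[] := kappa_bnd j.+1.
case: i ij => [|i] ij; first by left; rewrite r_0.
right; have rd := r_delta i.+1 j.+1 ij; have ri := r_gt0 i.
have /andP[d0 d4] := delta_bnd j.+1.
have h1 : 0 <= (1 + 2 * delta j.+1) * (delta j.+1 * r i.+1 - r j.+1).
  by rewrite mulr_ge0 ?subr_ge0//; lra.
have h2 : 0 <= delta j.+1 * (1 - 2 * delta j.+1) * r i.+1.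
  by apply: mulr_ge0 (ltW ri); apply: mulr_ge0 => //; lra.
rewrite /kappa; lra.
Qed.

(** For distinct components the one of smaller rate dominates, at the cost of
    its factor kappa; the bound is made symmetric in i and j in order to be
    summed. *)
Lemma convolution_expo_all i j x : 0 <= x ->
  (convolution (expo R (r i)) (expo R (r j)) `]x, +oo[%classic <=
   (kappa i * e i x + kappa j * e j x + (i == j)%:R * (r i * x * e i x))%:E)%E.
Proof.
move=> x0.
have ke n : 0 <= kappa n * e n x.
  by rewrite mulr_ge0 ?etail_ge0//; have /andP[] := kappa_bnd n; lra.
have [->|ij] := eqVneq i j; last rewrite mul0r addr0.
  rewrite convolution_expo_diag// lee_fin ?eqxx mul1r.
  by have := etail_ge0 R (r j) x; have /andP[] := kappa_bnd j; nra.
have [lt_ij|ge_ij] := ltnP i j.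
  by apply: le_trans (conv_lt _ _ _ x0 lt_ij) _; rewrite lee_fin lerDr.
rewrite convolutionC//; apply: le_trans (conv_lt _ _ _ x0 _) _.
  by rewrite ltn_neqAle eq_sym ij.
by rewrite lee_fin lerDl.
Qed.

Lemma tail_convolution_expmix_le x : 0 <= x ->
  ((tail (convolution F F) x)%:E <=
   \sum_(i <oo) (p i * (2 * (kappa i * e i x) + p i * (r i * x * e i x)))%:E)%E.
Proof.
move=> x0.
have rxe n : 0 <= r n * x * e n x.
  rewrite mulr_ge0 ?etail_ge0// mulr_ge0//.
  by case: n => [|n]; [rewrite r_0|exact: ltW].
rewrite -tailE /F convolution_mixture -(@weighted_double_sum _ _ _ _ 2)//; last first.
  move=> n; have := etail_ge0 R (r n) x; have := etail_le1 R (r n) x x0.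
  by have /andP[] := kappa_bnd n; nra.
apply: lee_nneseries => i _.
  by rewrite mule_ge0 ?lee_fin// nneseries_ge0// => j _ _; rewrite mule_ge0// lee_fin.
rewrite lee_wpmul2l ?lee_fin//; apply: lee_nneseries => j _.
  by rewrite mule_ge0// lee_fin.
by rewrite lee_wpmul2l ?lee_fin//; exact: convolution_expo_all.
Qed.

Let expR_lin_le (y : R) : 1 + y <= 2 * expR (y / 2).
Proof. by have := expR_ge1Dx (y / 2); lra. Qed.

Lemma etail_next n x : 0 <= x ->
  expR (- (r n.+1 * x / 4)) <= e n.+2 x.
Proof.
move=> x0; rewrite /etail r_gt0 ler_expR.
have rd : r n.+2 <= r n.+1 / 4.
  have := r_delta n.+1 n.+2; rewrite /= ltnSn => /(_ isT).
  have /andP[_] := delta_bnd n.+2; have := r_gt0 n; nra.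
by have := ler_wpM2r x0 rd; lra.
Qed.

(** With y = r_(n+1) x, the component n+1 is at most of order exp(- y / 2),
    while the component n+2 is at least p_(n+2) exp(- y / 4): the latter wins as
    soon as exp(- y / 4) is below a multiple of p_(n+2). *)
Lemma excess_deep eps n x : 0 < eps -> 0 <= x ->
  expR (- (r n.+1 * x / 4)) <= eps / 2 * p n.+2 ->
  p n.+1 * (4 * delta n.+1 + p n.+1 * (r n.+1 * x)) * e n.+1 x <=
  eps * (p n.+2 * e n.+2 x).
Proof.
move=> eps0 x0; have en := etail_next n x x0.
have -> : e n.+1 x = expR (- (r n.+1 * x)).
  by rewrite /etail r_gt0 mulNr.
have y0 : 0 <= r n.+1 * x by rewrite mulr_ge0// ltW.
move: en y0; set y := r n.+1 * x; set q := expR (- (y / 4)) => en y0 hq.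
have q0 : 0 < q by exact: expR_gt0.
have -> : expR (- y) = q ^+ 4.
  by rewrite /q -expRM_natl; congr expR; rewrite -[4%:R]/(4 : R); lra.
have hy : 1 + y <= 2 * q^-1 ^+ 2.
  rewrite /q -expRN opprK -expRM_natl; apply: (le_trans (expR_lin_le y)).
  by rewrite ler_pM2l// ler_expR -[2%:R]/(2 : R); lra.
have hyq : (1 + y) * q ^+ 4 <= 2 * q ^+ 2.
  have := ler_wpM2r (exprn_ge0 4 (ltW q0)) hy.
  have -> : 2 * q^-1 ^+ 2 * q ^+ 4 = 2 * q ^+ 2 by field; rewrite gt_eqF.
  by [].
have p1 := expmix_weight_le1 n.+1; have p0 := p_ge0 n.+1.
have /andP[d0 d4] := delta_bnd n.+1.
have h : p n.+1 * (4 * delta n.+1 + p n.+1 * y) <= 1 + y.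
  have h1 : p n.+1 * y <= y by rewrite ler_piMl.
  have h2 : 0 <= 4 * delta n.+1 + p n.+1 * y by rewrite addr_ge0// mulr_ge0.
  by apply: (@le_trans _ _ (4 * delta n.+1 + p n.+1 * y)); [rewrite ler_piMl|lra].
apply: (le_trans (ler_wpM2r (exprn_ge0 4 (ltW q0)) h)).
apply: (le_trans hyq).
have hqq : q * q <= eps / 2 * p n.+2 * e n.+2 x.
  by rewrite ler_pM// ltW.
by rewrite expr2; lra.
Qed.

(** For i large, either p_i r_i x is small and the excess is absorbed by the
    component i itself, or r_i x is at least of order 1 / p_i and, by [p_slow],
    the component i+1 absorbs it as in [excess_deep]. The remaining finitely
    many i are handled by taking x large. *)
Lemma excess_le eps : 0 < eps -> exists X, forall x, X <= x -> 0 <= x -> forall i,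
  p i * (4 * delta i + p i * (r i * x)) * e i x <=
  eps * (p i * e i x + p i.+1 * e i.+1 x).
Proof.
move=> eps0; have eps8 : 0 < eps / 8 by rewrite divr_gt0.
have [J1 HJ1] := delta_cvg _ eps8.
have [J2 HJ2] := p_slow _ eps8.
pose g n := 8 / (eps * p n.+2 * r n.+1).
have g_gt0 n : 0 < g n by rewrite divr_gt0// !mulr_gt0.
exists (\sum_(n < maxn J1 J2) g n) => x Xx x0 [|n].
  rewrite /etail r_0 ltxx !mulr0 add0r -/(etail R _ x).
  by rewrite mulr_ge0 ?weighted_etail_ge0// ltW.
have pe1 := weighted_etail_ge0 n.+1 x; have pe2 := weighted_etail_ge0 n.+2 x.
have y0 : 0 <= r n.+1 * x by rewrite mulr_ge0// ltW.
have deep : expR (- (r n.+1 * x / 4)) <= eps / 2 * p n.+2 ->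
    p n.+1 * (4 * delta n.+1 + p n.+1 * (r n.+1 * x)) * e n.+1 x <=
    eps * (p n.+1 * e n.+1 x + p n.+2 * e n.+2 x).
  move=> /(excess_deep _ _ _ eps0 x0) /le_trans; apply.
  by rewrite ler_pM2l// lerDr.
have [Jn|nJ] := leqP (maxn J1 J2) n.+1.
  have [small|large] := leP (p n.+1 * (r n.+1 * x)) (eps / 2).
    have dn : delta n.+1 <= eps / 8.
      by apply: HJ1; rewrite (leq_trans _ Jn)// leq_maxl.
    have h : 4 * delta n.+1 + p n.+1 * (r n.+1 * x) <= eps by lra.
    have := ler_wpM2r pe1 h.
    have : 0 <= eps * (p n.+2 * e n.+2 x) by rewrite mulr_ge0// ltW.
    lra.
  apply: deep.
  have := HJ2 n.+1 (leq_trans (leq_maxr _ _) Jn).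
  have pp := p_gt0 n.+1.
  have : expR (- (r n.+1 * x / 4)) <= expR (- (eps / 8 / p n.+1)).
    rewrite ler_expR lerN2 ler_pdivrMr ?p_gt0//.
    by move: large; lra.
  move=> /le_trans h /h h2; apply: (le_trans h2).
  by rewrite ler_pM2r//; lra.
apply: deep.
have gx : g n <= x.
  apply: le_trans Xx.
  have nJ' : (n < maxn J1 J2)%N by exact: ltn_trans nJ.
  rewrite (bigD1 (Ordinal nJ'))//= lerDl sumr_ge0// => i _; exact: ltW.
have pp := p_gt0 n.+1; have rr := r_gt0 n.
have y8 : 8 <= eps * p n.+2 * (r n.+1 * x).
  move: gx; rewrite /g ler_pdivrMr ?mulr_gt0//; lra.
have ypos : 0 < r n.+1 * x.
  rewrite lt_neqAle y0 andbT eq_sym; apply/eqP => y_eq0.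
  by move: y8; rewrite y_eq0 mulr0 leNgt ltr0n.
have : expR (- (r n.+1 * x / 4)) <= (r n.+1 * x / 4)^-1.
  rewrite expRN lef_pV2 ?posrE ?expR_gt0 ?divr_gt0//.
  by have := expR_ge1Dx (r n.+1 * x / 4); lra.
move=> /le_trans; apply.
rewrite invf_div ler_pdivrMr//; lra.
Qed.

Lemma expmix_subexponential : subexponential F.
Proof.
apply: subexponential_upper; [exact: expmix_Rplus|exact: expmix_unbounded|].
move=> eps eps0; have e2 : 0 < eps / 2 by rewrite divr_gt0.
have [X HX] := excess_le _ e2.
exists (Num.max 0 X) => x; rewrite ge_max => /andP[x0 Xx].
have t0 := tail_ge0 _ F x.
rewrite -lee_fin; apply: (le_trans (tail_convolution_expmix_le _ x0)).
apply: (@le_trans _ _ (\sum_(i <oo) ((2 + eps / 2)%:E * (p i * e i x)%:E +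
    (eps / 2)%:E * (p i.+1 * e i.+1 x)%:E))%E).
  apply: lee_nneseries => i _.
    rewrite lee_fin mulr_ge0// addr_ge0// mulr_ge0 ?mulr_ge0 ?etail_ge0//.
    - by have /andP[] := kappa_bnd i; lra.
    - by case: i => [|n]; [rewrite r_0|exact: ltW].
  rewrite -!EFinM -EFinD lee_fin; have := HX x Xx x0 i; rewrite /kappa; lra.
rewrite nneseriesD; last 2 first.
- by move=> i _ _; rewrite mule_ge0// lee_fin ?weighted_etail_ge0//; lra.
- by move=> i _ _; rewrite mule_ge0// lee_fin ?weighted_etail_ge0//; lra.
rewrite !nneseriesZl; last 2 first.
- by move=> i _; rewrite lee_fin weighted_etail_ge0.
- by move=> i _; rewrite lee_fin weighted_etail_ge0.
have shift : (\sum_(i <oo) (p i.+1 * e i.+1 x)%:E <= (tail F x)%:E)%E.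
  rewrite tail_expmix//.
  apply: (@nneseries_shift_le _ (fun n => (p n * e n x)%:E)) => n.
  by rewrite lee_fin weighted_etail_ge0.
rewrite -tail_expmix//.
apply: (@le_trans _ _ ((2 + eps / 2)%:E * (tail F x)%:E + (eps / 2)%:E * (tail F x)%:E)%E).
  by rewrite leeD2l// lee_wpmul2l// lee_fin ltW.
by rewrite -!EFinM -EFinD lee_fin; lra.
Qed.

End subexp.

Section not_subexp.
Hypothesis r_sep : forall i j, (0 < i < j)%N -> 4 * r j <= r i.
Hypothesis r_small : forall M, exists k, M <= (r k.+1)^-1.
Hypothesis p_fast : forall k, p k.+2 <= p k.+1 ^+ 2 * expR (- (1 + (p k.+1)^-1)).

(* The point u_k is where the component k+1 has tail exp(- L k), and L k - 1 is
   the inverse of its weight. *)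
Let L k := 1 + (p k.+1)^-1.
Let u k := L k / r k.+1.

Let L_ge1 k : 1 <= L k.
Proof. by rewrite lerDl invr_ge0. Qed.

Let u_ge0 k : 0 <= u k.
Proof. by rewrite divr_ge0// ?(ltW (r_gt0 _))// (le_trans ler01). Qed.

Let e_u k : e k.+1 (u k) = expR (- L k).
Proof.
rewrite /etail r_gt0; congr expR; rewrite /u; field.
by rewrite gt_eqF.
Qed.

(** At u_k the variable r_(k+1) x equals L k, so the excess of the pair
    (k+1, k+1) over twice its tail is
    (L k - 1) exp(- L k) = exp(- L k) / p_(k+1). *)
Lemma tail_convolution_expmix_ge k :
  2 * tail F (u k) + p k.+1 * expR (- L k) <=
  tail (convolution F F) (u k) + tail F (u k) ^+ 2.
Proof.
set x := u k; have x0 : 0 <= x by exact: u_ge0.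
pose d i := (i == k.+1)%:R * ((p k.+1)^-1 * expR (- L k)).
have d0 i : 0 <= d i by rewrite !mulr_ge0// ?invr_ge0 ?expR_ge0.
have pt i j : ((e i x + e j x + (i == j)%:R * d i)%:E <=
    convolution (expo R (r i)) (expo R (r j)) `]x, +oo[%classic +
    (e i x * e j x)%:E)%E.
  have [->{i}|ij] := eqVneq i j; last first.
    rewrite mul0r addr0.
    have := @convolution_ge _ _ _ x (expo_Rplus _ (r i)) (expo_Rplus _ (r j)) x0.
    by rewrite !expo_itv.
  rewrite mul1r /d; have [->|jk] := eqVneq j k.+1; last first.
    rewrite mul0r addr0.
    have := @convolution_ge _ _ _ x (expo_Rplus _ (r j)) (expo_Rplus _ (r j)) x0.
    by rewrite !expo_itv.
  rewrite convolution_expo_diag// mul1r e_u -EFinD lee_fin.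
  have -> : r k.+1 * x = L k by rewrite /x /u mulrC divfK// gt_eqF.
  by rewrite [in leRHS]/L; have := expR_ge0 (- L k); nra.
have pe0 := fun n => weighted_etail_ge0 n x.
have conv2 : ((tail (convolution F F) x + tail F x ^+ 2)%:E =
    \sum_(i <oo) (p i)%:E * (\sum_(j <oo) (p j)%:E *
      (convolution (expo R (r i)) (expo R (r j)) `]x, +oo[%classic +
      (e i x * e j x)%:E)))%E.
  rewrite EFinD -tailE /F convolution_mixture.
  transitivity (\sum_(i <oo) ((p i)%:E * (\sum_(j <oo) (p j)%:E *
      convolution (expo R (r i)) (expo R (r j)) `]x, +oo[%classic) +
      (tail F x)%:E * (p i * e i x)%:E))%E.
    rewrite nneseriesD; last 2 first.
    - move=> i _ _; rewrite mule_ge0 ?lee_fin// nneseries_ge0// => j _ _.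
      by rewrite mule_ge0// lee_fin.
    - move=> i _ _; rewrite mule_ge0//; first by rewrite lee_fin tail_ge0.
      by rewrite lee_fin pe0.
    by rewrite nneseriesZl -?tail_expmix// => i _; rewrite lee_fin.
  apply: eq_eseriesr => i _.
  have -> : ((tail F x)%:E * (p i * e i x)%:E = (p i)%:E * ((e i x)%:E * (tail F x)%:E))%E.
    by rewrite -!EFinM; congr EFin; ring.
  rewrite tail_expmix// -ge0_muleDr; last 2 first.
  - by rewrite nneseries_ge0// => j _ _; rewrite mule_ge0// lee_fin.
  - by rewrite mule_ge0 ?lee_fin ?etail_ge0// nneseries_ge0// => j _ _; rewrite lee_fin.
  congr (_ * _)%E; rewrite -nneseriesZl; last by move=> j _; rewrite lee_fin.
  rewrite -nneseriesD; last 2 first.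
  - by move=> j _ _; rewrite mule_ge0// lee_fin.
  - by move=> j _ _; rewrite mule_ge0// lee_fin// etail_ge0.
  apply: eq_eseriesr => j _.
  have ee : (0 <= (e i x * e j x)%:E)%E by rewrite lee_fin mulr_ge0// etail_ge0.
  rewrite (ge0_muleDr _ (measure_ge0 _ _) ee).
  by congr (_ + _)%E; rewrite -!EFinM; congr EFin; ring.
rewrite -lee_fin conv2.
apply: (@le_trans _ _ (\sum_(i <oo) (p i * (2 * e i x + p i * d i))%:E)%E).
  under eq_eseriesr.
    move=> i _.
    have -> : p i * (2 * e i x + p i * d i) =
        2 * (p i * e i x) + (k.+1 == i)%:R * (p k.+1 * expR (- L k)).
      rewrite /d eq_sym; have [->|_] := eqVneq i k.+1; last by rewrite !mul0r; ring.
      by rewrite !mul1r; field; rewrite gt_eqF.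
    rewrite EFinD EFinM.
    over.
  rewrite nneseriesD; last 2 first.
  - by move=> i _ _; rewrite mule_ge0// lee_fin.
  - by move=> i _ _; rewrite lee_fin !mulr_ge0// expR_ge0.
  rewrite nneseriesZl; last by move=> i _; rewrite lee_fin.
  by rewrite nneseries_single ?mulr_ge0 ?expR_ge0// -tail_expmix.
rewrite -(@weighted_double_sum _ _ _ _ 1)//; last first.
  by move=> n; rewrite etail_ge0 etail_le1.
apply: lee_nneseries => i _.
  rewrite mule_ge0 ?lee_fin// nneseries_ge0// => j _ _; rewrite mule_ge0 ?lee_fin//.
  by rewrite !addr_ge0 ?etail_ge0// mulr_ge0.
rewrite lee_wpmul2l ?lee_fin//; apply: lee_nneseries => j _.
  by rewrite mule_ge0 ?lee_fin// !addr_ge0 ?etail_ge0// mulr_ge0.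
by rewrite lee_wpmul2l ?lee_fin.
Qed.

Let p_decr k : p k.+2 <= p k.+1.
Proof.
apply: (le_trans (p_fast k)); rewrite expr2 -mulrA ler_piMr//.
rewrite -[leRHS]mulr1 ler_pM ?expR_ge0 ?expmix_weight_le1//.
by rewrite -[leRHS]expR0 ler_expR oppr_le0 (le_trans ler01)// L_ge1.
Qed.

Let p_mono k n : (k <= n)%N -> p n.+1 <= p k.+1.
Proof.
elim: n => [|n ih]; first by rewrite leqn0 => /eqP ->.
by rewrite leq_eqVlt => /predU1P[->//|/ih]; exact: le_trans.
Qed.

Let p_tail k n : (k <= n)%N -> p n.+2 <= p n.+1 * (p k.+1 * expR (- L k)).
Proof.
move=> kn; apply: (le_trans (p_fast n)).
rewrite expr2 -mulrA ler_wpM2l// ler_pM ?expR_ge0// ?p_mono//.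
by rewrite ler_expR lerN2 /L lerD2l lef_pV2 ?posrE// p_mono.
Qed.

(** At u_k the earlier components have decayed to exp(- 4 L k), and the later
    ones are small by their weights alone: the weight n+2 is at most the weight
    n+1 times p_(k+1) exp(- L k), so that they sum up to at most that factor. *)
Lemma tail_expmix_le k : tail F (u k) <= 3 * (p k.+1 * expR (- L k)).
Proof.
set c := p k.+1 * expR (- L k); set x := u k.
have c0 : 0 <= c by rewrite mulr_ge0// expR_ge0.
have x0 : 0 <= x by exact: u_ge0.
have e4c : expR (- (4 * L k)) <= c.
  have -> : - (4 * L k) = - (3 * L k) + - L k by ring.
  rewrite expRD ler_wpM2r ?expR_ge0//.
  apply: (@le_trans _ _ (expR (- (p k.+1)^-1))).
    by rewrite ler_expR lerN2 /L; have := invr_ge0 (p k.+1); rewrite p_ge0; lra.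
  rewrite expRN -[leRHS]invrK lef_pV2 ?posrE ?invr_gt0 ?expR_gt0//.
  by have := expR_ge1Dx (p k.+1)^-1; lra.
have pt n : p n.+1 * e n.+1 x <= c * p n.+1 + ((k == n)%:R * c + c * p n).
  have [nk|kn|->] := ltngtP n k.
  - rewrite mulrC mul0r add0r ler_wpDr ?mulr_ge0// ler_wpM2r//.
    apply: le_trans e4c; rewrite /etail r_gt0 ler_expR mulNr lerN2.
    have := r_sep n.+1 k.+1; rewrite /= ltnS nk => /(_ isT) r4.
    have := ler_wpM2r x0 r4.
    by rewrite -mulrA [_ * x]mulrC /x /u divfK ?gt_eqF.
  - case: n kn => // n kn.
    rewrite mul0r add0r ler_wpDl ?mulr_ge0// [leRHS]mulrC.
    apply: (le_trans _ (p_tail k n kn)).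
    by rewrite ler_piMr// etail_le1.
  - by rewrite mul1r e_u -/c ler_wpDl ?mulr_ge0// lerDl mulr_ge0.
rewrite -lee_fin tail_expmix//.
rewrite nneseries_recl//; last by move=> i _; rewrite lee_fin weighted_etail_ge0.
have -> : e 0 x = 0 by rewrite /etail r_0 ltxx.
rewrite mulr0 add0e -(@nneseries_addn R (fun n => (p n * e n x)%:E) 1%N); last first.
  by move=> i; rewrite lee_fin weighted_etail_ge0.
under eq_eseriesr do rewrite addn1.
have cp_ge0 n : (0 <= (c * p n)%:E)%E by rewrite lee_fin mulr_ge0.
apply: (@le_trans _ _ (\sum_(n <oo) ((c * p n.+1)%:E +
    (((k == n)%:R * c)%:E + (c * p n)%:E)))%E).
  apply: lee_nneseries => n _; first by rewrite lee_fin weighted_etail_ge0.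
  by rewrite -!EFinD lee_fin.
rewrite nneseriesD//; last first.
  by move=> n _ _; rewrite adde_ge0// lee_fin mulr_ge0.
rewrite nneseriesD//; last by move=> n _ _; rewrite lee_fin mulr_ge0.
have cp : (\sum_(n <oo) (c * p n)%:E = c%:E)%E.
  under eq_eseriesr do rewrite EFinM.
  by rewrite nneseriesZl ?p_sum1 ?mule1// => n _; rewrite lee_fin.
rewrite nneseries_single// cp.
have -> : (3 * c)%:E = (c%:E + (c%:E + c%:E))%E by rewrite -!EFinD; congr EFin; ring.
rewrite leeD2r// -[leRHS]cp.
exact: (@nneseries_shift_le _ (fun n => (c * p n)%:E)).
Qed.

Lemma expmix_not_subexponential : ~ subexponential F.
Proof.
apply: (@not_subexponential_along _ F u 3^-1) => // M.
have [k Mk] := r_small M; exists k; split.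
  apply: (le_trans Mk); rewrite /u -[leLHS]mul1r ler_wpM2r ?L_ge1//.
  by rewrite invr_ge0 ltW.
have := tail_convolution_expmix_ge k; have := tail_expmix_le k; lra.
Qed.

End not_subexp.
End exponential_mixture.

(** * A fast growing sequence of scales *)

Section scales.
Context (R : realType) (m : nat) (C : R).
Hypothesis C1 : 1 <= C.

Variable v : nat -> R.
(* The summand 2 m + 4 makes each scale at least the square of the previous
   one, and 8 C is what the comparison of the tilted weights needs. *)
Hypothesis v0 : v 0 = (2 * m + 4)%:R + 8 * C.
Hypothesis vS : forall k, v k.+1 = expR (v k ^+ (2 * m + 3) / (2 * m + 4)%:R).

Let init_gt : 12 <= (2 * m + 4)%:R + 8 * C.
Proof.
have : 4 <= (2 * m + 4)%:R :> R by rewrite (ler_nat R 4) leq_addl.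
by move: C1; set a := _%:R; lra.
Qed.

Lemma scale_step (k : nat) : (2 * m + 4)%:R + 8 * C <= v k -> v k ^+ 2 <= v k.+1.
Proof.
move=> vk; have vk1 : 1 <= v k.
  by move: vk init_gt; set a := _%:R; lra.
have vkm : (2 * m + 4)%:R <= v k.
  by move: vk C1; set a := _%:R; lra.
have m4 : 0 < (2 * m + 4)%:R :> R by rewrite ltr0n addn_gt0 orbT.
apply: (@le_trans _ _ (1 + v k ^+ (2 * m + 3) / (2 * m + 4)%:R)); last by rewrite vS expR_ge1Dx.
apply: (@le_trans _ _ (v k ^+ (2 * m + 3) / (2 * m + 4)%:R)); last by rewrite lerDr.
have -> : v k ^+ (2 * m + 3) = v k * v k ^+ (2 * m + 2).
  by rewrite -exprS; congr (_ ^+ _); lia.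
rewrite ler_pdivlMr// [leLHS]mulrC.
have vk0 : 0 <= v k by lra.
apply: ler_pM; [exact: ltW|exact: exprn_ge0|exact: vkm|].
by rewrite ler_weXn2l// leq_addl.
Qed.

Lemma scale_init k : (2 * m + 4)%:R + 8 * C <= v k.
Proof.
elim: k => [|k ih]; first by rewrite v0.
apply: le_trans (scale_step k ih).
have h : 1 <= v k by move: ih init_gt; set a := _%:R; lra.
by apply: (le_trans ih); rewrite expr2 ler_peMl// (le_trans ler01).
Qed.

Lemma scale_ge12 k : 12 <= v k.
Proof. exact: le_trans (scale_init k). Qed.

Lemma scale_gt0 k : 0 < v k.
Proof. by apply: lt_le_trans (scale_ge12 k). Qed.

Lemma scale_sqr k : v k ^+ 2 <= v k.+1.
Proof. exact: scale_step (scale_init k). Qed.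

Lemma scale_mono i j : (i <= j)%N -> v i <= v j.
Proof.
move=> /subnK <-; elim: (j - i)%N => [//|k ih].
rewrite addSn; apply: (le_trans ih); apply: (le_trans _ (scale_sqr _)).
rewrite expr2 ler_peMl//; [exact/ltW/scale_gt0|].
by have := scale_ge12 (k + i); lra.
Qed.

Lemma scale_ge_exp2 k : 2 ^+ k.+1 <= v k.
Proof.
elim: k => [|k ih]; first by have := scale_ge12 0; rewrite expr1; lra.
rewrite exprS; apply: (le_trans _ (scale_sqr _)).
by have := scale_ge12 k; nra.
Qed.

Lemma scale_unbounded (M : R) : exists J, forall j, (J <= j)%N -> M <= v j.
Proof.
exists (Num.bound M) => j Jj; apply: le_trans (scale_mono _ _ Jj).
apply: le_trans (scale_ge_exp2 _); exact/ltW/upper_nthrootP.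
Qed.

(** The inverse of the next weight is the exponential of a power of the
    current scale, with an exponent one below the one that gives the inverse
    of the current weight. *)
Lemma scale_expn k : v k.+1 ^+ (2 * m + 4) = expR (v k ^+ (2 * m + 3)).
Proof.
rewrite vS -expRM_natl; congr expR.
by rewrite mulrC divfK// pnatr_eq0 addn4.
Qed.

Lemma scale_expn_half k : v k.+1 ^+ (m + 2) = expR (v k ^+ (2 * m + 3) / 2).
Proof.
rewrite vS -expRM_natl; congr expR.
have -> : (2 * m + 4)%:R = 2 * (m + 2)%:R :> R by rewrite -natrM; congr _%:R; lia.
have : (m + 2)%:R != 0 :> R by rewrite pnatr_eq0 addn2.
by move: (_%:R : R) => a a0; field.
Qed.

End scales.

(** * Weights and rates *)

Section with_atom.
Context (R : realType).
Implicit Types a : nat -> R.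

(** The missing mass is put at index 0, which carries the atom. *)
Definition with_atom a (n : nat) : R :=
  if n is k.+1 then a k else 1 - fine (\sum_(n <oo) (a n)%:E)%E.

(** A convenient sufficient condition for a total mass at most 1. *)
Definition dyadic a := forall n, 0 <= a n <= (2 ^+ n.+1)^-1.

Lemma dyadic_sum_le1 a : dyadic a -> (\sum_(n <oo) (a n)%:E <= 1)%E.
Proof.
move=> aP; have h := @cvg_geometric_eseries_half R 1 0.
have <- : (\sum_(n <oo) ((2 ^+ n.+1)^-1)%:E = 1 :> \bar R)%E.
  transitivity ((1 / 2 ^+ 0 : R)%:E); last by rewrite expr0 divr1.
  rewrite -(cvg_lim _ h)//; apply: congr_lim; apply/funext => n.
  apply: eq_bigr => i _; congr EFin.
  by rewrite addn1 natrX div1r.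
apply: lee_nneseries => n _; rewrite lee_fin; by have /andP[] := aP n.
Qed.

Lemma dyadic_sum_fin a : dyadic a -> (\sum_(n <oo) (a n)%:E)%E \is a fin_num.
Proof.
move=> aP; rewrite ge0_fin_numE.
  exact: (le_lt_trans (dyadic_sum_le1 _ aP) (ltry 1)).
by apply: nneseries_ge0 => n _ _; rewrite lee_fin; have /andP[] := aP n.
Qed.

Lemma with_atom_ge0 a : dyadic a -> forall n, 0 <= with_atom a n.
Proof.
move=> aP [|n]/=; last by have /andP[] := aP n.
by rewrite subr_ge0 -lee_fin fineK ?dyadic_sum_le1// dyadic_sum_fin.
Qed.

Lemma with_atom_sum1 a : dyadic a -> (\sum_(n <oo) (with_atom a n)%:E = 1)%E.
Proof.
move=> aP; rewrite nneseries_recl//; last first.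
  by move=> n _; rewrite lee_fin with_atom_ge0.
rewrite -(@nneseries_addn R (fun n => (with_atom a n)%:E) 1%N); last first.
  by move=> i; rewrite lee_fin with_atom_ge0.
under eq_eseriesr do rewrite addn1.
have := dyadic_sum_fin _ aP; rewrite /with_atom => S.
by rewrite EFinB fineK// subeK.
Qed.

End with_atom.

Section weights_and_rates.
Context (R : realType) (m : nat) (C : R).
Hypothesis C1 : 1 <= C.

Variable v : nat -> R.
Hypothesis v0 : v 0 = (2 * m + 4)%:R + 8 * C.
Hypothesis vS : forall k, v k.+1 = expR (v k ^+ (2 * m + 3) / (2 * m + 4)%:R).

Let v_gt0 k : 0 < v k. Proof. exact: (scale_gt0 _ _ _ C1 _ v0 vS k). Qed.
Let v_ge1 k : 1 <= v k. Proof. by have := scale_ge12 _ _ _ C1 _ v0 vS k; lra. Qed.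
Let vX_gt0 k n : 0 < v k ^+ n. Proof. exact: exprn_gt0. Qed.
Let vX_ge1 k n : 1 <= v k ^+ n. Proof. exact: exprn_ege1. Qed.

Definition weight (n : nat) : R := (v n.+1 ^+ (2 * m + 4))^-1.
Definition rate (n : nat) : R := if n is k.+1 then (v k.+1 ^+ (m + 2))^-1 else 0.

Lemma rate_gt0 n : 0 < rate n.+1.
Proof. by rewrite invr_gt0. Qed.

Lemma weight_gt0 n : 0 < weight n.
Proof. by rewrite invr_gt0. Qed.

Lemma invX_dyadic n k : (0 < k)%N -> (v n.+1 ^+ k)^-1 <= (2 ^+ n.+1)^-1.
Proof.
move=> k0; rewrite lef_pV2 ?posrE ?exprn_gt0//.
apply: (@le_trans _ _ (v n.+1)).
  apply: le_trans (scale_ge_exp2 _ _ _ C1 _ v0 vS n.+1).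
  by rewrite ler_weXn2l// ler1n.
by rewrite -[leLHS]expr1 ler_weXn2l.
Qed.

Lemma dyadic_weight : dyadic R weight.
Proof. by move=> n; rewrite (ltW (weight_gt0 n)) invX_dyadic// addn4. Qed.

(** A bound for the ratios of the rate n to the earlier positive rates. *)
Definition gap_ratio (n : nat) : R := (v n.-1)^-1.

Lemma gap_ratio_bnd n : 0 <= gap_ratio n <= 4^-1.
Proof.
rewrite invr_ge0 (ltW (v_gt0 _))/= lef_pV2 ?posrE//.
by have := scale_ge12 _ _ _ C1 _ v0 vS n.-1; lra.
Qed.

Lemma gap_ratio_cvg eps : 0 < eps ->
  exists J, forall j, (J <= j)%N -> gap_ratio j <= eps.
Proof.
move=> eps0; have [J HJ] := scale_unbounded _ _ _ C1 _ v0 vS eps^-1.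
exists J.+1 => -[//|j] Jj; rewrite /gap_ratio/= -[leRHS]invrK.
by rewrite lef_pV2 ?posrE ?invr_gt0//; exact: HJ.
Qed.

Lemma rate_ratio i j : (0 < i < j)%N -> rate j <= gap_ratio j * rate i.
Proof.
case: i j => [//|a] [//|b]; rewrite /= ltnS => ab.
rewrite /gap_ratio/= -invfM lef_pV2 ?posrE ?mulr_gt0//.
apply: (@le_trans _ _ (v b ^+ 2 ^+ (m + 2))); last first.
  apply: lerXn2r; [exact/ltW/vX_gt0|exact/ltW/v_gt0|exact: (scale_sqr _ _ _ C1 _ v0 vS b)].
rewrite -exprM; apply: (@le_trans _ _ (v b * v b ^+ (m + 2))).
  rewrite ler_pM2l//; apply: lerXn2r; [exact/ltW/v_gt0|exact/ltW/v_gt0|].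
  exact: (scale_mono _ _ _ C1 _ v0 vS _ _ ab).
by rewrite -exprS ler_weXn2l//; lia.
Qed.

Lemma rate_sep i j : (0 < i < j)%N -> 4 * rate j <= rate i.
Proof.
move=> ij; have := rate_ratio _ _ ij; have /andP[d0 d4] := gap_ratio_bnd j.
case: i ij => [//|i] _; have := rate_gt0 i; nra.
Qed.

Lemma rate_small M : exists k, M <= (rate k.+1)^-1.
Proof.
have [J HJ] := scale_unbounded _ _ _ C1 _ v0 vS M.
exists J; rewrite /rate invrK; apply: (le_trans (HJ J.+1 (leqnSn _))).
by rewrite -[leLHS]expr1 ler_weXn2l// addn2.
Qed.

Let expRN_inv_le (q : R) : 0 < q -> expR (- q^-1) <= q.
Proof.
move=> q0; rewrite expRN -[leRHS]invrK lef_pV2 ?posrE ?invr_gt0 ?expR_gt0//.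
by have := expR_ge1Dx q^-1; lra.
Qed.

(** Since 1 / p_j = v_j^(2m+4) and p_(j+1) = exp(- v_j^(2m+3)), this holds
    once v_j exceeds a multiple of 1 / eps. *)
Lemma weight_slow eps : 0 < eps ->
  exists J, forall j, (J <= j)%N ->
    expR (- (eps / with_atom R weight j)) <= eps * with_atom R weight j.+1.
Proof.
move=> eps0; have [J HJ] := scale_unbounded _ _ _ C1 _ v0 vS (2 / eps).
exists J.+1 => -[//|j] Jj; rewrite /with_atom /weight invrK.
rewrite (scale_expn _ _ _ vS j.+1) -expRN.
apply: (@le_trans _ _ (expR (- eps^-1) * expR (- v j.+1 ^+ (2 * m + 3)))); last first.
  by rewrite ler_wpM2r ?expR_ge0 ?expRN_inv_le.
rewrite -expRD ler_expR.
have -> : v j.+1 ^+ (2 * m + 4) = v j.+1 * v j.+1 ^+ (2 * m + 3).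
  by rewrite -exprS; congr (_ ^+ _); lia.
have vj : 2 / eps <= v j.+1 by apply: HJ; exact: ltnW.
have h : v j.+1 <= v j.+1 ^+ (2 * m + 3).
  by rewrite -[leLHS]expr1 ler_weXn2l// addn3.
have ev : 2 <= eps * v j.+1 by move: vj; rewrite ler_pdivrMr// mulrC.
have := ler_wpM2r (ltW (vX_gt0 j.+1 (2 * m + 3))) ev.
have : 2 * eps^-1 <= v j.+1 by [].
have := vX_gt0 j.+1 (2 * m + 3).
lra.
Qed.

Section tilted.
Variable c : nat -> R.
Hypothesis c_bnd : forall n,
  v n.+1 ^+ 2 / C <= c n <= v n.+1 ^+ (m + 2).

(** The weights of the distribution whose tail is the tail integral; c_n is
    the Laplace transform of the kernel at the rate n+1. *)
Definition tilted n := weight n * c n.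

Let c_gt0 n : 0 < c n.
Proof.
have /andP[h _] := c_bnd n; apply: lt_le_trans h; rewrite divr_gt0//.
exact: lt_le_trans C1.
Qed.

Lemma tilted_gt0 n : 0 < tilted n.
Proof. by rewrite mulr_gt0// weight_gt0. Qed.

Let tilted_le n : tilted n <= (v n.+1 ^+ (m + 2))^-1.
Proof.
have /andP[_ h] := c_bnd n; rewrite /tilted /weight mulrC ler_pdivrMr//.
apply: (le_trans h); rewrite ler_pdivlMl// -exprD.
by rewrite ler_weXn2l//; lia.
Qed.

Lemma dyadic_tilted : dyadic R tilted.
Proof.
move=> n; rewrite (ltW (tilted_gt0 n))/=; apply: le_trans (tilted_le n) _.
by apply: invX_dyadic; rewrite addn2.
Qed.

(** Here 1 / q_k <= C v^(2m+2) with v the scale of index k, whereas q_(k+1)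
    is at most exp(- v^(2m+3) / 2); the choice of the first scale gives
    v >= 8 C. *)
Lemma tilted_fast k : with_atom R tilted k.+2 <=
  with_atom R tilted k.+1 ^+ 2 * expR (- (1 + (with_atom R tilted k.+1)^-1)).
Proof.
rewrite /with_atom; apply: (le_trans (tilted_le k.+1)).
have q0 := tilted_gt0 k; set q := tilted k in q0 *.
have /andP[h _] := c_bnd k.
have C0 : 0 < C by exact: lt_le_trans C1.
set w := v k.+1 in h.
have qT : q^-1 <= C * w ^+ (2 * m + 2).
  rewrite /q /tilted /weight invfM invrK -/w ler_pdivrMr//.
  have -> : w ^+ (2 * m + 4) = w ^+ (2 * m + 2) * w ^+ 2.
    by rewrite -exprD; congr (_ ^+ _); lia.
  rewrite [C * _]mulrC -mulrA ler_pM2l//; first by rewrite -ler_pdivrMl// mulrC.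
  exact: vX_gt0.
rewrite (scale_expn_half _ _ _ C1 _ vS k.+1) -/w -expRN.
have w8 : 8 * C <= w.
  have := scale_init _ _ _ C1 _ v0 vS k.+1; rewrite -/w.
  have : 0 <= (2 * m + 4)%:R :> R by [].
  by set a := _%:R; lra.
have w3 : w ^+ (2 * m + 3) = w * w ^+ (2 * m + 2).
  by rewrite -exprS; congr (_ ^+ _); lia.
have w1 : 1 <= w ^+ (2 * m + 2) by exact: vX_ge1.
have T1 : 1 <= C * w ^+ (2 * m + 2) by rewrite mulr_ege1.
have q2 : expR (- q^-1) ^+ 2 <= q ^+ 2.
  by apply: lerXn2r; [exact: expR_ge0|exact: ltW|exact: expRN_inv_le].
apply: le_trans (ler_wpM2r (expR_ge0 _) q2).
rewrite expr2 -!expRD ler_expR w3.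
have := ler_wpM2r (le_trans ler01 w1) w8.
lra.
Qed.

End tilted.
End weights_and_rates.

(** * Moments and tail integrals of mixtures *)

Section moments_and_tail_integrals.
Context (R : realType).

Let measurable_expRMl (t : R) : measurable_fun [set: R] (fun y : R => expR (t * y)).
Proof.
apply: (measurableT_comp (@measurable_expR R)); exact: mulrl_measurable.
Qed.

(** From r x / 2 <= exp(r x / 2), the integrand is at most 4 / r times the
    density of the exponential law of rate r / 2. *)
Lemma expo_mean_le (r : R) : 0 < r ->
  (\int[expo R r]_x `|x : R|%:E <= (4 / r)%:E)%E.
Proof.
move=> r0; rewrite integral_expo//; last first.
  by apply/measurable_EFinP; exact: normr_measurable.
have r2 : 0 < r / 2 by rewrite divr_gt0.
have -> : (4 / r)%:E = ((4 / r)%:E * (expR (- (r / 2) * 0))%:E)%E.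
  by rewrite mulr0 expR0 mule1.
have m2 : measurable_fun [set: R] (fun y : R => (r / 2 * expR (- (r / 2) * y))%:E).
  apply/measurable_EFinP.
  exact: (measurable_funM (measurable_cst (r / 2)) (measurable_expRMl (- (r / 2)))).
have m1 : measurable_fun [set: R] (fun y : R => (r * expR (- r * y))%:E).
  apply/measurable_EFinP.
  exact: (measurable_funM (measurable_cst r) (measurable_expRMl (- r))).
have r40 : (0 <= (4 / r)%:E :> \bar R)%E by rewrite lee_fin divr_ge0// ltW.
rewrite -integral_expR_itvy// -ge0_integralZl//; last 2 first.
- exact: measurable_funTS.
- by move=> x _; rewrite lee_fin mulr_ge0 ?expR_ge0// ltW.
apply: ge0_le_integral => //.
- by move=> x _; rewrite mule_ge0// lee_fin mulr_ge0 ?expR_ge0// ltW.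
- apply/measurable_funTS/emeasurable_funM => //.
  by apply/measurable_EFinP; exact: normr_measurable.
- by apply/measurable_funTS; exact: measurable_funeM.
- move=> x /=; rewrite in_itv/= andbT => x0.
  rewrite -!EFinM lee_fin ger0_norm//.
  have -> : - r * x = - (r / 2) * x + - (r / 2) * x by field.
  rewrite expRD; set q := expR (- (r / 2) * x).
  have q0 : 0 < q by exact: expR_gt0.
  have h : (1 + r / 2 * x) * q <= 1.
    have -> : q = (expR (r / 2 * x))^-1 by rewrite -expRN /q mulNr.
    by rewrite ler_pdivrMr ?expR_gt0// mul1r expR_ge1Dx.
  have -> : 4 / r * (r / 2 * q) = 2 * q by field; rewrite gt_eqF.
  have -> : x * (r * (q * q)) = 2 * (r / 2 * x * q) * q by field.
  by rewrite ler_pM2r// ; lra.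
Qed.

Lemma expmix_finite_mean (p r : nat -> R) (p0 : forall n, 0 <= p n)
    (p1 : (\sum_(n <oo) (p n)%:E = 1)%E) : r 0%N = 0 -> (forall n, 0 < r n.+1) ->
  (\sum_(n <oo) (p n.+1 / r n.+1)%:E < +oo)%E ->
  finite_mean (expmix R p r p0 p1).
Proof.
move=> r0 rgt fin; apply/integrableP; split; first exact/measurable_EFinP.
have mN : measurable_fun [set: R] (fun x : R => `|x|%:E).
  by apply/measurable_EFinP; exact: normr_measurable.
under eq_integral do rewrite abse_EFin.
rewrite integral_mixture// nneseries_recl//; last first.
  by move=> n _; rewrite mule_ge0 ?lee_fin// integral_ge0.
rewrite r0 integral_dirac_expo// normr0 mule0 add0e.
rewrite -(@nneseries_addn R (fun n =>
  (p n)%:E * \int[expo R (r n)]_x `|x : R|%:E)%E 1%N); last first.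
  by move=> n; rewrite mule_ge0 ?lee_fin// integral_ge0.
under eq_eseriesr do rewrite addn1.
apply: (@le_lt_trans _ _ (4%:E * \sum_(n <oo) (p n.+1 / r n.+1)%:E)%E).
  rewrite -nneseriesZl; last by move=> n _; rewrite lee_fin divr_ge0// ltW.
  apply: lee_nneseries => n _.
    by rewrite mule_ge0 ?lee_fin// integral_ge0.
  have -> : (4%:E * (p n.+1 / r n.+1)%:E = (p n.+1)%:E * (4 / r n.+1)%:E)%E.
    by rewrite -!EFinM; congr EFin; ring.
  by rewrite lee_wpmul2l ?lee_fin//; exact: expo_mean_le.
by rewrite lte_mul_pinfty// lee_fin.
Qed.

(** The exponential e_n(x + y) factors as e_n(x) e_n(y), so each component
    keeps its rate and has its weight multiplied by the Laplace transform of
    the kernel. *)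
Lemma integral_tail_expmix (p r : nat -> R) (p0 : forall n, 0 <= p n)
    (p1 : (\sum_(n <oo) (p n)%:E = 1)%E) (D : set R) (k : R -> R) (c : nat -> R) :
  r 0%N = 0 -> (forall n, 0 < r n.+1) ->
  measurable D -> D `<=` [set y | 0 <= y] ->
  (forall y, D y -> 0 <= k y) -> measurable_fun D k ->
  (forall n, \int[lebesgue_measure]_(y in D) (expR (- r n.+1 * y) * k y)%:E =
     (c n)%:E)%E ->
  forall x, 0 <= x ->
  (\int[lebesgue_measure]_(y in D) (tail (expmix R p r p0 p1) (x + y) * k y)%:E =
   \sum_(n <oo) (p n.+1 * c n * etail R (r n.+1) x)%:E)%E.
Proof.
move=> r0 rgt mD D0 k0 mk cE x x0.
pose f n y := ((p n.+1 * expR (- r n.+1 * x)) * (expR (- r n.+1 * y) * k y))%:E.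
have f0 n y : D y -> (0 <= f n y)%E.
  by move=> Dy; rewrite lee_fin !mulr_ge0 ?expR_ge0// k0.
have mek n : measurable_fun D (fun y => expR (- r n.+1 * y) * k y).
  by apply: measurable_funM => //; apply: measurable_funTS.
transitivity (\int[lebesgue_measure]_(y in D) (\sum_(n <oo) f n y))%E.
  apply: eq_integral => y; rewrite inE => Dy.
  rewrite mulrC EFinM tail_expmix ?addr_ge0//; last exact: D0.
  have y0 : 0 <= x + y by rewrite addr_ge0//; exact: D0.
  rewrite -nneseriesZl; last first.
    by move=> n _; rewrite lee_fin mulr_ge0// etail_ge0.
  rewrite nneseries_recl//; last first.
    by move=> n _; rewrite -EFinM lee_fin !mulr_ge0 ?etail_ge0// k0.
  rewrite r0 /(etail R 0) ltxx mulr0 mule0 add0e.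
  rewrite -(@nneseries_addn R (fun n =>
    (k y)%:E * (p n * etail R (r n) (x + y))%:E)%E 1%N); last first.
    by move=> n; rewrite -EFinM lee_fin !mulr_ge0 ?etail_ge0// k0.
  apply: eq_eseriesr => n _; rewrite addn1 -EFinM /f; congr EFin.
  by rewrite /etail rgt mulrDr expRD; ring.
rewrite integral_nneseries//; last first.
  move=> n; apply/measurable_EFinP.
  exact: (measurable_funM (measurable_cst _) (mek n)).
apply: eq_eseriesr => n _; rewrite /f.
under eq_integral do rewrite EFinM.
rewrite ge0_integralZl//; last 3 first.
- by apply/measurable_EFinP; exact: mek.
- by move=> y Dy; rewrite lee_fin mulr_ge0 ?expR_ge0// k0.
- by rewrite lee_fin mulr_ge0 ?expR_ge0.
by rewrite cE -EFinM /etail rgt; congr EFin; ring.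
Qed.

End moments_and_tail_integrals.

(** * The construction for a general kernel *)

Section counterexample.
Context (R : realType).

Lemma laplace_le (D : set R) (k : R -> R) (r : R) : 0 < r ->
  measurable D -> D `<=` [set y | 0 <= y] ->
  (forall y, D y -> 0 <= k y <= 1) -> measurable_fun D k ->
  (\int[lebesgue_measure]_(y in D) (expR (- r * y) * k y)%:E <= (r^-1)%:E)%E.
Proof.
move=> r0 mD D0 k01 mk.
have mexp : measurable_fun [set: R] (fun y : R => expR (- r * y)).
  apply: (measurableT_comp (@measurable_expR R)); exact: mulrl_measurable.
have me : measurable_fun [set: R] (fun y : R => (r * expR (- r * y))%:E).
  apply/measurable_EFinP; exact: (measurable_funM (measurable_cst r) mexp).
have e0 y : (0 <= (r * expR (- r * y))%:E :> \bar R)%E.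
  by rewrite lee_fin mulr_ge0 ?expR_ge0// ltW.
have ri0 : (0 <= (r^-1)%:E :> \bar R)%E by rewrite lee_fin invr_ge0 ltW.
have m2 : measurable_fun [set: R] (fun y : R => ((r^-1)%:E * (r * expR (- r * y))%:E)%E).
  exact: measurable_funeM.
have D0' : D `<=` `[0, +oo[%classic.
  by move=> y /D0 /=; rewrite in_itv/= andbT.
apply: (@le_trans _ _ (\int[lebesgue_measure]_(y in `[0%R, +oo[)
    ((r^-1)%:E * (r * expR (- r * y))%:E))%E); last first.
  rewrite ge0_integralZl//; last exact: measurable_funTS.
  by rewrite integral_expR_itvy// mulr0 expR0 mule1.
apply: (@le_trans _ _ (\int[lebesgue_measure]_(y in D)
    ((r^-1)%:E * (r * expR (- r * y))%:E))%E); last first.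
  apply: ge0_subset_integral => //; first exact: measurable_funTS.
  by move=> y _; rewrite mule_ge0.
apply: ge0_le_integral => //.
- by move=> y Dy; rewrite lee_fin mulr_ge0 ?expR_ge0//; have /andP[] := k01 y Dy.
- apply/measurable_EFinP; apply: measurable_funM => //; exact: measurable_funTS.
- exact: measurable_funTS.
- move=> y Dy; rewrite -EFinM lee_fin mulKf ?gt_eqF//.
  by rewrite ler_piMr ?expR_ge0//; have /andP[] := k01 y Dy.
Qed.

(** The growth of the Laplace transform asked for at the rate w^(- (m+2)) is
    exactly what [tilted_fast] uses. *)
Lemma counterexample (m : nat) (C : R) (D : set R) (k : R -> R) : 1 <= C ->
  measurable D -> D `<=` [set y | 0 <= y] ->
  (forall y, D y -> 0 <= k y <= 1) -> measurable_fun D k ->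
  (forall w, 2 <= w -> ((w ^+ 2 / C)%:E <= \int[lebesgue_measure]_(y in D)
     (expR (- (w ^+ (m + 2))^-1 * y) * k y)%:E)%E) ->
  exists F G : distr R, [/\ subexponential F, finite_mean F,
    on_Rplus G /\ (forall x, 0 <= x -> ((tail G x)%:E = mine 1
      (\int[lebesgue_measure]_(y in D) (tail F (x + y) * k y)%:E))%E) &
    ~ subexponential G].
Proof.
move=> C1 mD D0 k01 mk lower.
have [v [v0 vS]] : exists v : nat -> R, v 0 = (2 * m + 4)%:R + 8 * C /\
    forall n, v n.+1 = expR (v n ^+ (2 * m + 3) / (2 * m + 4)%:R).
  by exists (fix v n := if n is k.+1 then expR (v k ^+ (2 * m + 3) / (2 * m + 4)%:R)
    else (2 * m + 4)%:R + 8 * C).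
have v12 n : 12 <= v n := scale_ge12 _ _ _ C1 _ v0 vS n.
have v_gt0 n : 0 < v n := scale_gt0 _ _ _ C1 _ v0 vS n.
pose p := with_atom R (weight R m v).
pose r := rate R m v.
have aP := dyadic_weight _ _ _ C1 _ v0 vS : dyadic R (weight R m v).
have p0 : forall n, 0 <= p n by exact: with_atom_ge0.
have p1 : (\sum_(n <oo) (p n)%:E = 1)%E by exact: with_atom_sum1.
have r0 : forall n, 0 < r n.+1 := rate_gt0 _ _ _ C1 _ v0 vS.
have wgt0 := weight_gt0 _ _ _ C1 _ v0 vS.
pose I n := (\int[lebesgue_measure]_(y in D) (expR (- r n.+1 * y) * k y)%:E)%E.
have I0 n : (0 <= I n)%E.
  apply: integral_ge0 => y Dy; rewrite lee_fin mulr_ge0 ?expR_ge0//.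
  by have /andP[] := k01 y Dy.
have Ile n : (I n <= (v n.+1 ^+ (m + 2))%:E)%E.
  by have := laplace_le D k _ (r0 n) mD D0 k01 mk; rewrite /r /rate invrK.
have Ifin n : I n \is a fin_num.
  by rewrite ge0_fin_numE//; apply: (le_lt_trans (Ile n)); exact: ltry.
pose c n := fine (I n).
have cP n : v n.+1 ^+ 2 / C <= c n <= v n.+1 ^+ (m + 2).
  rewrite -!lee_fin /c fineK// Ile andbT; apply: lower.
  by have := v12 n.+1; lra.
pose q := with_atom R (tilted R m v c).
have bP := dyadic_tilted _ _ _ C1 _ v0 vS _ cP : dyadic R (tilted R m v c).
have q0 : forall n, 0 <= q n by exact: with_atom_ge0.
have q1 : (\sum_(n <oo) (q n)%:E = 1)%E by exact: with_atom_sum1.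
have qgt0 := tilted_gt0 _ _ _ C1 _ v0 vS _ cP.
exists (expmix R p r p0 p1), (expmix R q r q0 q1); split.
- apply: (expmix_subexponential _ _ _ _ _ _ _ _ (gap_ratio R v)) => //.
  + exact: gap_ratio_bnd C1 _ v0 vS.
  + exact: gap_ratio_cvg C1 _ v0 vS.
  + exact: rate_ratio C1 _ v0 vS.
  + exact: weight_slow C1 _ v0 vS.
- apply: expmix_finite_mean => //.
  apply: (@le_lt_trans _ _ 1%E); last exact: ltry.
  apply: (@le_trans _ _ (\sum_(n <oo) ((v n.+1 ^+ (m + 2))^-1)%:E)%E).
    apply: lee_nneseries => n _; first by rewrite lee_fin divr_ge0// ltW.
    rewrite /p /r /with_atom /weight /rate invrK lee_fin ler_pdivrMl ?exprn_gt0//.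
    have -> : v n.+1 ^+ (2 * m + 4) = v n.+1 ^+ (m + 2) * v n.+1 ^+ (m + 2).
      by rewrite -exprD; congr (_ ^+ _); lia.
    by rewrite -mulrA divff ?mulr1// gt_eqF ?exprn_gt0.
  apply: dyadic_sum_le1 => n; rewrite invr_ge0 exprn_ge0 ?(ltW (v_gt0 _))//=.
  by apply: (invX_dyadic _ _ _ C1 _ v0 vS); rewrite addn2.
- split; first exact: expmix_Rplus.
  move=> x x0; rewrite (integral_tail_expmix R p r p0 p1 D k c)//; last 2 first.
  + by move=> y Dy; have /andP[] := k01 y Dy.
  + by move=> n; rewrite /c fineK.
  have tG := tail_expmix R q r q0 q1 x x0.
  have -> : (\sum_(n <oo) (p n.+1 * c n * etail R (r n.+1) x)%:E)%E =
      (tail (expmix R q r q0 q1) x)%:E.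
    rewrite tG [RHS]nneseries_recl//; last first.
      by move=> n _; rewrite lee_fin mulr_ge0// etail_ge0.
    rewrite /(etail R (r 0) x) /= ltxx mulr0 add0e.
    rewrite -(@nneseries_addn R (fun n => (q n * etail R (r n) x)%:E) 1%N); last first.
      by move=> n; rewrite lee_fin mulr_ge0// etail_ge0.
    by under [RHS]eq_eseriesr do rewrite addn1.
  apply/esym/min_idPr; rewrite -tailE; exact: probability_le1.
- apply: expmix_not_subexponential => //.
  + exact: rate_sep C1 _ v0 vS.
  + exact: rate_small C1 _ v0 vS.
  + exact: tilted_fast C1 _ v0 vS _ cP.
Qed.

End counterexample.

(** * The two kernels *)

Lemma laplace_cst (R : realType) (r : R) : 0 < r ->
  (\int[lebesgue_measure]_(y in `[0%R, +oo[) (expR (- r * y) * 1)%:E =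
   (r^-1)%:E)%E.
Proof.
move=> r0.
have m1 : measurable_fun [set: R] (fun y : R => (r * expR (- r * y))%:E).
  apply/measurable_EFinP; apply: measurable_funM => //.
  apply: (measurableT_comp (@measurable_expR R)); exact: mulrl_measurable.
transitivity (\int[lebesgue_measure]_(y in `[0%R, +oo[)
    ((r^-1)%:E * (r * expR (- r * y))%:E))%E.
  by apply: eq_integral => y _; rewrite -EFinM mulKf ?gt_eqF// mulr1.
rewrite ge0_integralZl//.
- by rewrite integral_expR_itvy// mulr0 expR0 mule1.
- exact: measurable_funTS.
- by move=> y _; rewrite lee_fin mulr_ge0 ?expR_ge0// ltW.
- by rewrite lee_fin invr_ge0 ltW.
Qed.

Section power_kernel.
Context (R : realType) (alpha : R).
Hypotheses (alpha0 : 0 <= alpha) (alpha1 : alpha < 1).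

Lemma measurable_powRV : measurable_fun [set: R] (fun y : R => (y `^ alpha)^-1).
Proof. by under eq_fun do rewrite -powRN; exact: measurable_powR. Qed.

(** With s = w^(m+2), restricting the integral to [1, s] gives at least
    (s - 1) s^(- alpha) / e, which is at least s^(1 - alpha) / (2 e). *)
Lemma powR_laplace_ge (m : nat) (w : R) : 2 <= (m + 2)%:R * (1 - alpha) -> 2 <= w ->
  ((w ^+ 2 / (2 * expR 1))%:E <= \int[lebesgue_measure]_(y in `[1%R, +oo[)
     (expR (- (w ^+ (m + 2))^-1 * y) * (y `^ alpha)^-1)%:E)%E.
Proof.
move=> hm w2; set s := w ^+ (m + 2).
have w0 : 0 < w by lra.
have s0 : 0 < s by exact: exprn_gt0.
have s2 : 2 <= s.
  apply: (le_trans w2); rewrite -[leLHS]expr1 ler_weXn2l//; last by rewrite addn2.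
  lra.
have sa : w ^+ 2 <= s / s `^ alpha.
  have -> : s / s `^ alpha = w `^ ((m + 2)%:R * (1 - alpha)).
    rewrite -powRN -[X in X * _](powRr1 (ltW s0)) -powRD; last first.
      by rewrite (gt_eqF s0) implybT.
    by rewrite powRrM powR_mulrn// ltW.
  rewrite -powR_mulrn ?(ltW w0)//; apply: ler_powR => //; lra.
have sa0 : 0 < s `^ alpha by exact: powR_gt0.
pose c := (expR 1)^-1 * (s `^ alpha)^-1.
have c0 : 0 <= c by rewrite mulr_ge0// invr_ge0 ?expR_ge0 ?powR_ge0.
have k0 (y : R) : 0 <= expR (- s^-1 * y) * (y `^ alpha)^-1.
  by rewrite mulr_ge0 ?expR_ge0// invr_ge0 powR_ge0.
have mk : measurable_fun [set: R] (fun y : R => expR (- s^-1 * y) * (y `^ alpha)^-1).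
  apply: measurable_funM; last exact: measurable_powRV.
  apply: (measurableT_comp (@measurable_expR R)); exact: mulrl_measurable.
apply: (@le_trans _ _ (\int[lebesgue_measure]_(y in `[1%R, s]) (cst c%:E y))%E).
  rewrite integral_cst//= lebesgue_measure_itv/= lte_fin ifT; last by lra.
  rewrite -EFinB -EFinM lee_fin /c -mulrA invfM.
  have e1 : 0 < (expR 1)^-1 :> R by rewrite invr_gt0 expR_gt0.
  have h : 2^-1 * w ^+ 2 <= (s `^ alpha)^-1 * (s - 1).
    apply: (@le_trans _ _ (2^-1 * (s / s `^ alpha))); first by rewrite ler_pM2l.
    have := invr_gt0 (s `^ alpha); rewrite sa0; nra.
  by have := ler_wpM2l (ltW e1) h; lra.
apply: (@le_trans _ _ (\int[lebesgue_measure]_(y in `[1%R, s])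
    (expR (- s^-1 * y) * (y `^ alpha)^-1)%:E)%E).
  apply: ge0_le_integral => //.
  - by apply/measurable_EFinP; exact: measurable_funTS.
  - move=> y /=; rewrite in_itv/= => /andP[y1 ys].
    have y0 : 0 < y by lra.
    rewrite lee_fin /c ler_pM ?invr_ge0 ?expR_ge0 ?powR_ge0//.
      rewrite -expRN ler_expR mulNr lerN2 mulrC ler_pdivrMr ?mul1r//.
    by rewrite lef_pV2 ?posrE ?powR_gt0//; apply: ge0_ler_powR; rewrite ?nnegrE// ltW.
apply: ge0_subset_integral => //.
- by apply/measurable_EFinP; exact: measurable_funTS.
- by move=> y _; rewrite lee_fin.
- by move=> y /=; rewrite !in_itv/= andbT => /andP[].
Qed.

End power_kernel.

Theorem mainTheorem6 (R : realType) :
  (forall alpha : R, 0 <= alpha -> alpha < 1 ->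
     exists F G : distr R,
       [/\ subexponential F, finite_mean F,
           is_G_alpha alpha F G & ~ subexponential G]) /\
  (exists F FI : distr R,
     [/\ subexponential F, finite_mean F,
         is_integrated_tail F FI & ~ subexponential FI]).
Proof.
split=> [alpha alpha0 alpha1|].
  (* chosen so that (n + 2) (1 - alpha) >= 2, as [powR_laplace_ge] requires *)
  have [n hn] : exists n : nat, 2 / (1 - alpha) <= n%:R.
    by exists (Num.bound (2 / (1 - alpha))); apply/ltW/archi_boundP; rewrite divr_ge0//; lra.
  have a1 : 0 < 1 - alpha by rewrite subr_gt0.
  apply: (@counterexample R n (2 * expR 1) `[1%R, +oo[%classic (fun y => (y `^ alpha)^-1)) => //.
  - by have := expR_ge1Dx (1 : R); lra.
  - by move=> y /=; rewrite in_itv/= andbT; lra.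
  - move=> y /=; rewrite in_itv/= andbT => y1.
    rewrite invr_ge0 powR_ge0/= -[leRHS]invr1 lef_pV2 ?posrE ?powR_gt0//; last by lra.
    by rewrite -(powRr0 y); apply: ler_powR.
  - apply: measurable_funTS; exact: measurable_powRV.
  - move=> w w2; apply: powR_laplace_ge => //.
    move: hn; rewrite ler_pdivrMr// natrD => hn.
    have : 0 <= 2 * (1 - alpha) by rewrite mulr_ge0// ltW.
    by move: hn; set a := _%:R; lra.
have [F [FI [F1 F2 [F3 F4] F5]]] : exists F G : distr R, [/\ subexponential F, finite_mean F,
    on_Rplus G /\ (forall x, 0 <= x -> ((tail G x)%:E = mine 1
      (\int[lebesgue_measure]_(y in `[0%R, +oo[) (tail F (x + y) * 1)%:E))%E) &
    ~ subexponential G].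
  apply: (@counterexample R 0 1 `[0%R, +oo[%classic (fun=> 1)) => //.
  - by move=> y /=; rewrite in_itv/= andbT.
  - by move=> y _; rewrite ler01 lexx.
  - move=> w w2; have w0 : 0 < w by lra.
    have s0 : 0 < (w ^+ (0 + 2))^-1 by rewrite invr_gt0 exprn_gt0.
    by rewrite laplace_cst// invrK divr1.
exists F, FI; split=> //; split=> // x x0.
rewrite F4 ?ltW//; congr (mine _ _); apply: eq_integral => y _.
by rewrite mulr1.
Qed.
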